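(* Let $(X,\mathcal{B},\mu)$ be a measure space with $\mu(X)=1$, let $k\in\mathbb{N}$, and let $\{\mathcal{T}_1^{q}\}_{q\in\mathbb{Q}},\ldots,\{\mathcal{T}_k^{q}\}_{q\in\mathbb{Q}}$ be $k$ commuting rational systems defined by measure preserving transformations $\{T_{n,j}\}_{n\in\mathbb{Z}^{\ast}}$, $1\leq j\leq k$, respectively, of $(X,\mathcal{B},\mu)$. If $A\in\mathcal{B}$ and $\mu(A)>0$, then there exists $q\in\mathbb{Q}^{\ast}$ with $$\mu\big(A\cap(\mathcal{T}_1^{q})^{-1}(A)\cap\ldots\cap(\mathcal{T}_k^{q})^{-1}(A)\big)>0.$$
   Context: Notation: $\mathbb{N}=\{1,2,\ldots\}$, $\mathbb{Z}^{\ast}=\mathbb{Z}\setminus\{0\}$, $\mathbb{Q}^{\ast}=\mathbb{Q}\setminus\{0\}$. Representation of rationals (known fact): every rational number $q$ has a unique expression $$q=\sum_{s=1}^{\infty}q_{-s}\frac{(-1)^{s}}{(s+1)!}+\sum_{r=1}^{\infty}q_{r}(-1)^{r+1}r!,$$ where $(q_n)_{n\in\mathbb{Z}^{\ast}}\subseteq\mathbb{N}\cup\{0\}$, $0\leq q_{-s}\leq s$ for every $s>0$, $0\leq q_r\leq r$ for every $r>0$, and $q_{-s}=q_r=0$ for all but finitely many $r,s$. For $q\in\mathbb{Q}^{\ast}$, the domain of $q$ is the non-empty finite set $dom(q)=\{t\in\mathbb{Z}^{\ast}: q_t\neq 0\}=\{t_1<\ldots<t_l\}$, and $q$ is represented as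 the word $q=q_{t_1}\ldots q_{t_l}$ (so $1\leq q_{t_i}\leq |t_i|$). Measure preserving transformation: a map $T:X\to X$ is a measure preserving transformation of $(X,\mathcal{B},\mu)$ if it is $\mathcal{B}$-measurable and $\mu(T^{-1}(A))=\mu(A)$ for every $A\in\mathcal{B}$. Rational system: let $\{T_n\}_{n\in\mathbb{Z}^{\ast}}$ be a set of (pairwise) commuting transformations of a set $X$. For a non-zero rational $q$ represented as the word $q=q_{t_1}\ldots q_{t_l}$, define $\mathcal{T}^{q}(x)=T_{t_1}^{q_{t_1}}\ldots T_{t_l}^{q_{t_l}}(x)$ (a composition of iterates), and $\mathcal{T}^{0}(x)=x$, for every $x\in X$. The family $\{\mathcal{T}^{q}\}_{q\in\mathbb{Q}}$ is the rational system (of transformations) defined by $\{T_n\}_{n\in\mathbb{Z}^{\ast}}$. Two rational systems $\{\mathcal{T}_1^{q}\}_{q\in\mathbb{Q}}$, $\{\mathcal{T}_2^{q}\}_{q\in\mathbb{Q}}$ defined by $\{T_{n,1}\}_{n\in\mathbb{Z}^{\ast}}$ and $\{T_{n,2}\}_{n\in\mathbb{Z}^{\ast}}$ respectively are commuting if $T_{n,1}T_{m,2}=T_{m,2}T_{n,1}$ for every $n,m\in\mathbb{Z}^{\ast}$. The $k$ rational systems are commuting if they are pairwise commuting. *)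

(* Defs.v *)
From HB Require Import structures.
From mathcomp Require Import all_boot all_order all_algebra.
From mathcomp Require Import finmap.
From mathcomp Require Import zify ring lra.
From mathcomp Require Import all_classical all_reals all_analysis.

Set Implicit Arguments.
Unset Strict Implicit.
Unset Printing Implicit Defensive.

Import Order.TTheory GRing.Theory Num.Theory.

Local Open Scope classical_set_scope.
Local Open Scope ring_scope.

(* The expansion is indexed by [int] instead of the nonzero integers: the bound
   on the digits forces [c 0 = 0].  Both series are finite sums, truncated at a
   rank [N] beyond which all digits vanish. *)
Definition has_digits (q : rat) (c : int -> nat) : Prop :=
  (forall n : int, (c n <= `|n|)%N) /\
  exists N : nat,
    (forall n : int, (N < `|n|)%N -> c n = 0%N) /\
    q = \sum_(1 <= s < N.+1) (c (- s%:Z))%:R * ((-1) ^+ s / (s.+1)`!%:R)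
      + \sum_(1 <= r < N.+1) (c r%:Z)%:R * ((-1) ^+ r.+1 * r`!%:R).

Definition fpart (a : nat -> nat) (N : nat) : rat :=
  \sum_(1 <= s < N.+1) (a s)%:R * ((-1) ^+ s / (s.+1)`!%:R).
Definition ipart (a : nat -> nat) (N : nat) : rat :=
  \sum_(1 <= r < N.+1) (a r)%:R * ((-1) ^+ r.+1 * r`!%:R).

Lemma fact_neq0 (n : nat) : (n`!%:R : rat) != 0.
Proof. by rewrite pnatr_eq0 -lt0n fact_gt0. Qed.

Lemma fpartS a N :
  fpart a N.+1 = fpart a N + (a N.+1)%:R * ((-1) ^+ N.+1 / (N.+2)`!%:R).
Proof. by rewrite /fpart big_nat_recr. Qed.

Lemma ipartS a N :
  ipart a N.+1 = ipart a N + (a N.+1)%:R * ((-1) ^+ N.+2 * (N.+1)`!%:R).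
Proof. by rewrite /ipart big_nat_recr. Qed.

Lemma eq_fpart a b N : (forall s, (1 <= s <= N)%N -> a s = b s) ->
  fpart a N = fpart b N.
Proof. by move=> ab; apply: eq_big_nat => i iN; rewrite ab. Qed.

Lemma signz (n : nat) : ((-1) ^+ n : int) * (-1) ^+ n = 1.
Proof. by rewrite -expr2 sqrr_sign. Qed.

Lemma signq (n : nat) : (((-1) ^+ n : int)%:~R : rat) = (-1) ^+ n.
Proof. by rewrite rmorphXn rmorphN1. Qed.

Lemma fpart_exists (S : nat) (z : int) : exists (a : nat -> nat) (w : int),
  (forall s, (a s <= s)%N) /\ z%:~R / (S.+1)`!%:R = w%:~R + fpart a S.
Proof.
elim: S z => [|S IH] z.
  exists (fun=> 0%N), z; split => //.
  by rewrite /fpart big_geq // addr0 divr1.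
pose y : int := (-1) ^+ S.+1 * z.
pose d := (y %% (S.+2)%:Z)%Z.
pose z' := (-1) ^+ S.+1 * (y %/ (S.+2)%:Z)%Z.
have zE : z = z' * (S.+2)%:Z + (-1) ^+ S.+1 * d.
  rewrite /z' -mulrA -mulrDr -divz_eq /y mulrA signz mul1r//.
have d0 : 0 <= d by rewrite modz_ge0.
have dS : d < (S.+2)%:Z by rewrite ltz_pmod.
have [a [w [aP aE]]] := IH z'.
exists (fun s => if s == S.+1 then `|d|%N else a s), w; split.
  by move=> s; case: eqP => [->|_] //; lia.
rewrite fpartS eqxx addrA.
rewrite (_ : fpart _ S = fpart a S); last first.
  by apply: eq_fpart => s /andP[_ sS]; case: eqP => // E; move: sS; rewrite E ltnn.
rewrite -aE.
have -> : (`|d|%N%:R : rat) = d%:~R by rewrite natr_absz ger0_norm.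
rewrite zE rmorphD !rmorphM /= signq (factS S.+1) natrM.
have f0 := fact_neq0 S.+1.
have S0 : ((S.+2)%:R : rat) != 0 by rewrite pnatr_eq0.
rewrite -[(S.+2)%:~R]/((S.+2)%:R : rat).
field.
by rewrite f0 /=; move: S0; rewrite !mulrS.
Qed.

Lemma ipart_exists_from (n m : nat) (z : int) :
  (`|z|.*2 + (z < 0)%R < n)%N -> (1 <= m)%N ->
  exists (a : nat -> nat) (N : nat),
    [/\ (m <= N)%N, forall r, (a r <= r)%N &
     (z%:~R * ((-1) ^+ m.+1 * m`!%:R) : rat) =
     \sum_(m <= r < N) (a r)%:R * ((-1) ^+ r.+1 * r`!%:R)].
Proof.
elim: n m z => [//|n IH] m z zn m1.
have [->|z0] := eqVneq z 0.
  by exists (fun=> 0%N), m; rewrite big_geq// mul0r.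
pose d := (z %% (m.+1)%:Z)%Z.
pose z' := - (z %/ (m.+1)%:Z)%Z.
have zE : z = d - z' * (m.+1)%:Z.
  by rewrite /z' mulNr opprK addrC -divz_eq.
have d0 : 0 <= d by rewrite modz_ge0.
have dm : d < (m.+1)%:Z by rewrite ltz_pmod.
have z'n : (`|z'|.*2 + (z' < 0)%R < n)%N.
  have h : (`|z'|.*2 + (z' < 0)%R < `|z|.*2 + (z < 0)%R)%N; last by lia.
  clearbody d z'; clear IH zn.
  have [zneg|zpos] := ltP z 0.
    have z'1 : 1 <= z' by nia.
    have -> : (z' < 0) = false by lia.
    have : z' * 2 <= 1 - z \/ z = -1 by nia.
    by nia.
  have z'1 : z' <= 0 by nia.
  have : (- z') * 2 <= z by nia.
  have [|] := ltP z' 0; lia.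
have [a [N [mN aP aE]]] := IH m.+1 z' z'n isT.
exists (fun r => if r == m then `|d|%N else a r), N; split => //.
- exact: ltnW.
- by move=> r; case: eqP => [->|_] //; lia.
rewrite big_ltn// eqxx.
rewrite (_ : \sum_(m.+1 <= r < N) _ =
   \sum_(m.+1 <= r < N) (a r)%:R * ((-1) ^+ r.+1 * r`!%:R)); last first.
  by apply: eq_big_nat => i /andP[mi _]; case: eqP => // E; move: mi; rewrite E ltnn.
rewrite -aE.
have -> : (`|d|%N%:R : rat) = d%:~R by rewrite natr_absz ger0_norm.
rewrite {1}zE rmorphB rmorphM /= (factS m) natrM exprS.
rewrite -[(m.+1)%:~R]/((m.+1)%:R : rat).
by rewrite [(-1) ^+ m.+2]exprS exprS; ring.
Qed.

Lemma has_digits_exists (q : rat) : exists c : int -> nat, has_digits q c.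
Proof.
pose D := `|denq q|%N.
have D0 : (0 < D)%N by rewrite absz_gt0.
have /dvdnP[e eE] : (D %| (D.+1)`!)%N by rewrite dvdn_fact// D0 leqnSn.
have qE : q = (numq q * e)%:~R / (D.+1)`!%:R.
  rewrite eE natrM rmorphM /= -{1}[q]divq_num_den.
  have -> : ((denq q)%:~R : rat) = D%:R by rewrite natr_absz ger0_norm.
  rewrite -[e%:~R]/(e%:R : rat).
  have D0' : (D%:R : rat) != 0 by rewrite pnatr_eq0 -lt0n.
  have e0 : (e%:R : rat) != 0.
    by rewrite pnatr_eq0; apply/eqP => e0; move: (fact_gt0 D.+1); rewrite eE e0.
  by field; rewrite D0' e0.
have [a [w [aP aE]]] := fpart_exists D (numq q * e).
have [b [N [N1 bP bE]]] :=
  @ipart_exists_from _ 1 w (ltnSn _) isT.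
pose M := maxn D N.
exists (fun n : int => match n with
  | Posz r => if (r < N)%N then b r else 0%N
  | Negz s => if (s.+1 <= D)%N then a s.+1 else 0%N end).
split.
  by move=> [r|s] /=; case: ifP.
exists M; split.
  move=> [r|s] /=; rewrite gtn_max => /andP[h1 h2].
    by rewrite ltnNge (ltnW h2).
  by rewrite leqNgt h1.
rewrite qE aE addrC; congr +%R.
  rewrite [RHS](big_cat_nat (n := D.+1))//=; last by rewrite ltnS leq_maxl.
  rewrite [X in _ = _ + X]big1_seq ?addr0; last first.
    move=> [|i] /andP[_]; rewrite mem_index_iota//= => /andP[Di _].
    by rewrite leqNgt Di mul0r.
  apply: eq_big_nat => -[|i] // /andP[_ iD].
  rewrite -[RHS]/((if (i < D)%N then a i.+1 else 0%N)%:R * ((-1) ^+ i.+1 / (i.+2)`!%:R)).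
  by rewrite -ltnS iD.
move: bE; rewrite (_ : (-1) ^+ 2 * 1`!%:R = 1 :> rat)// mulr1 => ->.
rewrite [RHS](big_cat_nat (n := N))//=; last by rewrite leqW// leq_maxr.
rewrite [X in _ = _ + X]big1_seq ?addr0; last first.
  move=> i /andP[_]; rewrite mem_index_iota//= => /andP[Ni _].
  by rewrite ltnNge Ni mul0r.
by apply: eq_big_nat => i /andP[_ ->].
Qed.

Lemma ipart_bound a b N : (forall r, (a r <= r)%N) -> (forall r, (b r <= r)%N) ->
  `|ipart a N - ipart b N| < (N.+1)`!%:R.
Proof.
move=> aP bP; elim: N => [|N IH].
  by rewrite /ipart !big_geq// subrr normr0.
rewrite !ipartS.
set u := ipart a N; set v := ipart b N in IH *.
rewrite (_ : _ - _ = (u - v) + ((a N.+1)%:R - (b N.+1)%:R) * ((-1) ^+ N.+2 * (N.+1)`!%:R)); last by ring.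
apply: le_lt_trans (ler_normD _ _) _.
rewrite normrM normrM normrX normrN1 expr1n mul1r (ger0_norm (ler0n _ _)).
rewrite (factS N.+1) mulSn natrD natrM.
apply: ltr_leD => //; apply: ler_wpM2r; first exact: ler0n.
have := aP N.+1; have := bP N.+1.
rewrite -!(ler_nat rat) => hb ha.
have a0 : (0 : rat) <= (a N.+1)%:R by exact: ler0n.
have b0 : (0 : rat) <= (b N.+1)%:R by exact: ler0n.
by rewrite ler_norml; apply/andP; split; lra.
Qed.

Lemma ipart_inj a b N : (forall r, (a r <= r)%N) -> (forall r, (b r <= r)%N) ->
  ipart a N = ipart b N -> forall r, (1 <= r <= N)%N -> a r = b r.
Proof.
move=> aP bP; elim: N => [|N IH] E r; first by case: r.
have f0 : (0 : rat) < (N.+1)`!%:R by rewrite ltr0n fact_gt0.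
have aNbN : a N.+1 = b N.+1.
  apply/eqP; apply/negPn/negP => ab.
  have := ipart_bound N aP bP; move: E; rewrite !ipartS => E.
  have -> : ipart a N - ipart b N =
     ((b N.+1)%:R - (a N.+1)%:R) * ((-1) ^+ N.+2 * (N.+1)`!%:R).
    by rewrite mulrBl; apply/eqP; rewrite subr_eq addrAC -addrA addrCA; apply/eqP; lra.
  rewrite normrM normrM normrX normrN1 expr1n mul1r (ger0_norm (ltW f0)).
  rewrite gtr_pMl// ltNge => /negP; apply.
  rewrite (_ : _ - _ = ((b N.+1)%:Z - (a N.+1)%:Z)%:~R); last by rewrite rmorphB.
  rewrite -intr_norm -[1]/(1%:~R) ler_int.
  by move: ab; lia.
move=> /andP[r1]; rewrite leq_eqVlt => /orP[/eqP->//|rN].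
by apply: IH; [move: E; rewrite !ipartS aNbN => /addIr | rewrite r1].
Qed.

(* Multiplying the fractional part by [(S + 1)!] makes it an integer. *)
Fixpoint fnum (a : nat -> nat) (S : nat) : int :=
  if S is S'.+1 then fnum a S' * (S'.+2)%:Z + (-1) ^+ S'.+1 * (a S'.+1)%:Z else 0.

Lemma fpartE a S : fpart a S = (fnum a S)%:~R / (S.+1)`!%:R.
Proof.
elim: S => [|S IH]; first by rewrite /fpart big_geq// mul0r.
rewrite fpartS IH -[fnum a S.+1]/(fnum a S * (S.+2)%:Z + (-1) ^+ S.+1 * (a S.+1)%:Z).
rewrite intrD !intrM signq (factS S.+1) natrM.
have f0 := fact_neq0 S.+1.
have S0 : ((S.+2)%:R : rat) != 0 by rewrite pnatr_eq0.
rewrite -[(S.+2)%:~R]/((S.+2)%:R : rat) -[(a S.+1)%:~R]/((a S.+1)%:R : rat).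
field.
by rewrite f0 /=; move: S0; rewrite !mulrS.
Qed.

Lemma fnum_inj a b S (k : int) : (forall r, (a r <= r)%N) -> (forall r, (b r <= r)%N) ->
  fnum a S - fnum b S = k * ((S.+1)`!)%:Z ->
  k = 0 /\ forall s, (1 <= s <= S)%N -> a s = b s.
Proof.
move=> aP bP; elim: S k => [|S IH] k /=.
  by rewrite subrr mulr1 => <-; split => // -[].
rewrite (factS S.+1) PoszM => E.
have haS := aP S.+1; have hbS := bP S.+1.
have ab : a S.+1 = b S.+1.
  have [t tE] : exists t : int, (a S.+1)%:Z - (b S.+1)%:Z = t * (S.+2)%:Z.
    exists ((-1) ^+ S.+1 * (k * ((S.+1)`!)%:Z - fnum a S + fnum b S)).
    have := signz S.+1; move: E; set e := (-1) ^+ S.+1 => E ee.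
    have E' : e * ((a S.+1)%:Z - (b S.+1)%:Z) =
        (k * ((S.+1)`!)%:Z - fnum a S + fnum b S) * (S.+2)%:Z.
      apply/eqP; rewrite -subr_eq0; move/eqP: E; rewrite -subr_eq0 => /eqP E.
      by apply/eqP; rewrite -[RHS]E; ring.
    by rewrite -mulrA -E' mulrA ee mul1r.
  have : t = 0 by nia.
  by move=> t0; move: tE; rewrite t0 mul0r; lia.
have : fnum a S - fnum b S = k * ((S.+1)`!)%:Z.
  apply: (@mulIf _ (S.+2)%:Z) => //.
  by move: E; rewrite ab; lia.
move=> /IH[k0 H]; split => // s /andP[s1].
by rewrite leq_eqVlt => /orP[/eqP->//|sS]; apply: H; rewrite s1.
Qed.

Lemma ipart_int a N : exists z : int, ipart a N = z%:~R.
Proof.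
elim: N => [|N [z zE]]; first by exists 0; rewrite /ipart big_geq.
exists (z + (a N.+1)%:Z * ((-1) ^+ N.+2 * ((N.+1)`!)%:Z)).
by rewrite ipartS zE intrD intrM (intrM _ ((-1) ^+ N.+2)) signq.
Qed.

Lemma digits_widen (f : nat -> rat) (a : nat -> nat) (M N : nat) : (M <= N)%N ->
  (forall s, (M < s)%N -> a s = 0%N) ->
  \sum_(1 <= s < M.+1) (a s)%:R * f s = \sum_(1 <= s < N.+1) (a s)%:R * f s.
Proof.
move=> MN a0; rewrite [RHS](big_cat_nat (n := M.+1))//=.
rewrite [X in _ = _ + X]big1_seq ?addr0// => s /andP[_].
by rewrite mem_index_iota => /andP[/a0-> _]; rewrite mul0r.
Qed.

Lemma has_digits_unique (q : rat) (c c' : int -> nat) :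
  has_digits q c -> has_digits q c' -> c =1 c'.
Proof.
move=> [cP [N [cN cq]]] [c'P [N' [c'N c'q]]].
pose M := maxn N N'.
have NM : (N <= M)%N := leq_maxl _ _.
have N'M : (N' <= M)%N := leq_maxr _ _.
pose a s := c (- s%:Z); pose a' s := c' (- s%:Z).
pose b r := c r%:Z; pose b' r := c' r%:Z.
have aP s : (a s <= s)%N by rewrite (leq_trans (cP _))// abszN.
have a'P s : (a' s <= s)%N by rewrite (leq_trans (c'P _))// abszN.
have bP s : (b s <= s)%N by exact: cP.
have b'P s : (b' s <= s)%N by exact: c'P.
have E : fpart a M + ipart b M = fpart a' M + ipart b' M.
  transitivity q.
    rewrite cq; congr +%R; symmetry.
      by apply: (@digits_widen _ a) => // s sN; rewrite /a cN// abszN.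
    by apply: (@digits_widen _ b) => // s sN; rewrite /b cN.
  rewrite c'q; congr +%R.
    by apply: (@digits_widen _ a') => // s sN; rewrite /a' c'N// abszN.
  by apply: (@digits_widen _ b') => // s sN; rewrite /b' c'N.
have [z zE] := ipart_int b M; have [z' z'E] := ipart_int b' M.
have f0 := fact_neq0 M.+1.
have /(fnum_inj aP a'P)[z0 aa'] : fnum a M - fnum a' M = (z' - z) * ((M.+1)`!)%:Z.
  apply: (@intr_inj rat); rewrite rmorphM !rmorphB /=.
  move: E; rewrite zE z'E !fpartE -[((M.+1)`!)%:~R]/((M.+1)`!%:R : rat) => E.
  apply: (mulIf (invr_neq0 f0)); rewrite mulfK// mulrBl.
  by lra.
have bb' : forall r, (1 <= r <= M)%N -> b r = b' r.
  by apply: (ipart_inj bP b'P); rewrite zE z'E; congr _%:~R; lia.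
move=> n; have [nM|Mn] := leqP `|n| M; last first.
  by rewrite cN ?c'N// (leq_ltn_trans _ Mn).
have [->|n0] := eqVneq n 0.
  by have := cP 0; have := c'P 0; rewrite absz0 !leqn0 => /eqP-> /eqP->.
have [np|nn] := ltP 0 n.
  by have := bb' `|n|%N; rewrite /b /b' gez0_abs ?ltW//; apply; lia.
have := aa' `|n|%N; rewrite /a /a' lez0_abs// opprK; apply; lia.
Qed.

Definition digit (q : rat) : int -> nat := projT1 (cid (has_digits_exists q)).

Lemma digitP (q : rat) : has_digits q (digit q).
Proof. exact: projT2 (cid _). Qed.

Definition dom (q : rat) : seq int :=
  sort <=%O (fset_set [set t : int | digit q t != 0%N]).

Lemma mem_dom (q : rat) (t : int) : (t \in dom q) = (digit q t != 0%N).
Proof.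
rewrite mem_sort in_fset_set; last first.
  have [_ [N [cN _]]] := digitP q.
  apply: (@sub_finite_set _ _ ((fun i : nat => i%:Z - N%:Z) @` `I_(N + N).+1)).
    move=> t' /= t'0; have t'N : (absz t' <= N)%N.
      by rewrite leqNgt; apply: contra t'0 => /cN ->.
    by exists (absz (t' + N%:Z)) => /=; lia.
  exact/finite_image/finite_II.
by apply/idP/idP; rewrite inE.
Qed.

(* [T 0] is irrelevant, since [0] is never in [dom q]. *)
Definition rational_system (X : Type) (T : int -> X -> X) (q : rat) : X -> X :=
  foldr (fun (t : int) (f : X -> X) => iter (digit q t) (T t) \o f) idfun (dom q).

Lemma rational_system0 (X : Type) (T : int -> X -> X) :
  rational_system T 0 = idfun.
Proof.
rewrite /rational_system.
suff -> : dom 0 = [::] by [].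
have d0 : has_digits 0 (fun=> 0%N).
  split => //; exists 0%N; split => //.
  by rewrite !big_geq// addr0.
case E : (dom 0) => [//|t s].
have : t \in dom 0 by rewrite E mem_head.
by rewrite mem_dom (has_digits_unique (digitP 0) d0).
Qed.

Definition measure_preserving (d : measure_display) (X : measurableType d)
    (R : realType) (mu : {measure set X -> \bar R}) (T : X -> X) : Prop :=
  measurable_fun setT T /\
  forall A : set X, measurable A -> mu (T @^-1` A) = mu A.

Definition commuting_transformations (X : Type) (T : int -> X -> X) : Prop :=
  forall n m : int, n != 0 -> m != 0 -> T n \o T m =1 T m \o T n.

Definition commuting_systems (X : Type) (T1 T2 : int -> X -> X) : Prop :=
  forall n m : int, n != 0 -> m != 0 -> T1 n \o T2 m =1 T2 m \o T1 n.

(* Main.v *)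
Require Import Defs.
From mathcomp Require Import all_boot all_order all_algebra.
From mathcomp Require Import all_classical all_reals all_analysis.
From mathcomp Require Import measurable_realfun finmap ring lra.

(** The theorem follows from the density Hales-Jewett theorem: for every
finite nonempty alphabet [K] and every [delta > 0], if [n] is large then every
set of words of length [n] over [K] of density at least [delta] contains a
combinatorial line.

Take the alphabet [option 'I_k].  A word [w] of length [n] acts on [X] as the
composition of the maps [T j t] over the positions [t = 1, ..., n] whose letter
is [Some j]; positions with the letter [None] act trivially.  Every such action
preserves [mu], so on average over [x] the set of words sending [x] into [A] has
density [mu A], hence with positive probability it has density at least
[mu A / 2] and contains a line.  There are finitely many lines, so one of them,
[y], lies in this set for a set of [x] of positive measure
([line_of_returns]).  Let [q] be the rational number with digit 1 at the
wildcard positions of [y] and 0 elsewhere.  Since all the maps commute, replacing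
the wildcard of [y] by [Some j] amounts to applying the [q]-th map of the [j]-th
system after the action of the word where the wildcard is [None]
([act_word_line_point]); removing this common measure preserving action leaves
the intersection in the theorem.

The density Hales-Jewett theorem is proved by induction on the alphabet, from
[K] to [option K], along the lines of the argument of Polymath and of Dodos,
Kanellopoulos and Tyros.  Let [A] be a set of words over [option K] of density
[d] without a line, on a product of a block [M] and a remainder [Z].  If fixing
the block to some word increases the density, one passes to this section.
Otherwise all sections have density almost [d].  Then:
- the statement for [K], averaged over [Z], shows that in every subspace of the
  block of a fixed dimension some line over [K] lies in a positive proportion of
  the sections of [A]; a Ramsey theorem for lines ([line_ramsey]) yields a large
  subspace where this holds for every line over [K];
- a word [y] over [option K] with a letter [None] is itself a line over [K], and
  if that line lies in [A] then [y] does not.  So on the subspace [A] avoids a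
  set of positive density which is an intersection, over the letters [a] of [K],
  of sets that do not distinguish [None] from [Some a];
- the complement of such an intersection contains a subspace of prescribed
  dimension on which [A] has density larger than [d] by a constant
  ([insensitive_compl_increment]), because insensitive sets can be exhausted by
  disjoint subspaces, again by the statement for [K].
The resulting alternative is [density_increment]; iterating it contradicts the
absence of lines, as densities are at most 1. *)

Set Implicit Arguments.
Unset Strict Implicit.
Unset Printing Implicit Defensive.

Import Order.TTheory GRing.Theory Num.Theory.

Local Open Scope ring_scope.

(** * Averages over finite types *)

Section Averages.
Context {R : realFieldType}.

Definition avg (T : finType) (f : T -> R) : R := (\sum_x f x) / #|T|%:R.

Definition density (T : finType) (A : pred T) : R := avg (fun x => (A x)%:R).

Implicit Types S T : finType.

Lemma eq_avg T (f g : T -> R) : f =1 g -> avg f = avg g.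
Proof. by move=> fg; congr (_ / _); apply: eq_bigr. Qed.

Lemma le_avg T (f g : T -> R) : (forall x, f x <= g x) -> avg f <= avg g.
Proof.
move=> fg; rewrite ler_wpM2r ?invr_ge0 ?ler0n//.
by apply: ler_sum => x _.
Qed.

Lemma avgD T (f g : T -> R) : avg (fun x => f x + g x) = avg f + avg g.
Proof. by rewrite /avg big_split mulrDl. Qed.

Lemma avgZ T c (f : T -> R) : avg (fun x => c * f x) = c * avg f.
Proof. by rewrite /avg -mulr_sumr mulrA. Qed.

Lemma avgB T (f g : T -> R) : avg (fun x => f x - g x) = avg f - avg g.
Proof. by rewrite /avg sumrB mulrBl. Qed.

Lemma avg_cst T (c : R) : (0 < #|T|)%N -> avg (fun _ : T => c) = c.
Proof.
move=> T0; rewrite /avg sumr_const -[c *+ _]mulr_natr mulfK//.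
by rewrite pnatr_eq0 -lt0n.
Qed.

Lemma avg_exchange S T (f : S -> T -> R) :
  avg (fun x => avg (f x)) = avg (fun y => avg (f^~ y)).
Proof.
by rewrite /avg -!mulr_suml exchange_big/= -!mulrA; congr (_ * _); rewrite mulrC.
Qed.

Lemma avg_bij S T (h : S -> T) (f : T -> R) :
  bijective h -> avg f = avg (fun x => f (h x)).
Proof.
move=> bh; rewrite /avg (reindex h) /=; last exact: onW_bij.
by rewrite (bij_eq_card bh).
Qed.

Lemma avg_pair S T (f : S * T -> R) :
  avg f = avg (fun x => avg (fun y => f (x, y))).
Proof.
rewrite /avg -mulr_suml card_prod natrM invfM pair_big/= mulrA mulrAC.
by congr (_ / _ / _); apply: eq_bigr => -[].
Qed.

Lemma avg_lt_ex T (f : T -> R) c :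
  (0 < #|T|)%N -> c < avg f -> exists x, c < f x.
Proof.
move=> T0 cf; apply/existsP; apply: contraTT cf => /existsPn fc.
rewrite -leNgt -(avg_cst c T0); apply: le_avg => x.
by rewrite leNgt fc.
Qed.

Lemma avg_le_ex T (f : T -> R) c :
  (0 < #|T|)%N -> c <= avg f -> exists x, c <= f x.
Proof.
move=> T0 cf; apply/existsP; apply: contraTT cf => /existsPn fc.
rewrite -ltNge -(avg_cst c T0) ltr_pM2r ?invr_gt0 ?ltr0n//.
have /card_gt0P[x0 _] := T0.
rewrite (bigD1 x0)//= [ltRHS](bigD1 x0)//=; apply: ltr_leD; first by rewrite ltNge fc.
by apply: ler_sum => x _; rewrite ltW// ltNge fc.
Qed.

(** Markov's inequality for a function bounded by 1: the values below
[c / 2] contribute at most [c / 2] to the average. *)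
Lemma avg_half T (f : T -> R) c : 0 <= c -> (forall x, f x <= 1) -> c <= avg f ->
  c / 2 <= density (fun x => c / 2 <= f x).
Proof.
move=> c0 f1 cf; have [T0|T0] := posnP #|T|.
  by move: cf; rewrite /density /avg T0 invr0 !mulr0; lra.
suff : avg f <= density (fun x => c / 2 <= f x) + c / 2 by lra.
rewrite -[X in _ + X](avg_cst (T:=T))// -avgD; apply: le_avg => x.
by have := f1 x; case: (leP (c / 2) (f x)) => h /=; lra.
Qed.

(** Pigeonhole principle in averaged form: if the points of a set of density [c]
have witnesses in a finite type, a single witness serves a proportion
[c / #|W|] of all points. *)
Lemma popular_witness (Z W : finType) (G : pred Z) (rel : Z -> W -> bool) c : 0 < c ->
  c <= density G ->
  (forall z, G z -> exists w, rel z w) ->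
  exists w, c / #|W|%:R <= density (rel^~ w).
Proof.
move=> c0 cG Grel.
have Z0 : (0 < #|Z|)%N.
  rewrite lt0n; apply/eqP => Z0.
  by move: (lt_le_trans c0 cG); rewrite /density /avg Z0 invr0 mulr0 ltxx.
have W0 : (0 < #|W|)%N.
  have [z] := avg_lt_ex Z0 (lt_le_trans c0 cG).
  rewrite ltr0n lt0b => /Grel[w _]; by apply/card_gt0P; exists w.
apply: (avg_le_ex W0); rewrite /density -avg_exchange.
have -> : c / #|W|%:R = #|W|%:R^-1 * c by rewrite mulrC.
apply: (@le_trans _ _ (#|W|%:R^-1 * density G)).
  by rewrite ler_pM2l// invr_gt0 ltr0n.
rewrite -avgZ; apply: le_avg => z.
rewrite mulrC ler_pM2r ?invr_gt0 ?ltr0n//.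
case Gz : (G z); last by apply: sumr_ge0 => w _; rewrite ler0n.
have [w zw] := Grel z Gz; rewrite (bigD1 w)//= zw lerDl.
by apply: sumr_ge0 => v _; rewrite ler0n.
Qed.

Lemma density_le1 T (A : pred T) : density A <= 1.
Proof.
have [T0|T0] := posnP #|T|; first by rewrite /density /avg T0 invr0 mulr0 ler01.
rewrite -[leRHS](avg_cst (T:=T))//; apply: le_avg => x.
by case: (A x); rewrite ?lexx ?ler01.
Qed.

End Averages.

(** * Words, combinatorial lines and subspaces *)

Section Words.

Implicit Types K I J L : finType.

(** A line over [K] is a word over [option K] whose wildcard is the letter [None].
Thus the words over [option K] with a letter [None] are simultaneously points of
the cube over the larger alphabet and lines of the cube over the smaller one;
the induction on the alphabet rests on this double reading. *)
Definition line_point K I (y : {ffun I -> option K}) (a : K) : {ffun I -> K} :=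
  [ffun i => odflt a (y i)].

Definition is_line K I (y : {ffun I -> option K}) := [exists i, y i == None].

(** A subspace of the cube over [K] with coordinates [I] is a map [I -> K + J],
giving each coordinate either a constant letter or a parameter in [J].  It has
dimension [#|J|] when every parameter occurs, which is [nondegenerate]. *)
Definition subspace_point K I J (V : {ffun I -> K + J}) (u : {ffun J -> K}) :
  {ffun I -> K} :=
  [ffun i => match V i with inl c => c | inr j => u j end].

Definition nondegenerate K I J (V : {ffun I -> K + J}) :=
  [forall j, exists i, V i == inr j].

(** The same subspace over [option K]; evaluated at a line over [K] with
coordinates [J], it gives the image of that line under the subspace. *)
Definition lift_subspace K I J (V : {ffun I -> K + J}) : {ffun I -> option K + J} :=
  [ffun i => match V i with inl c => inl (Some c) | inr j => inr j end].

Definition lift_word K I (u : {ffun I -> K}) : {ffun I -> option K} :=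
  [ffun i => Some (u i)].

Definition comp_subspace K I J L (V : {ffun I -> K + J}) (W : {ffun J -> K + L}) :
    {ffun I -> K + L} :=
  [ffun i => match V i with inl c => inl c | inr j => W j end].

Definition word_join K I J (u : {ffun I -> K}) (v : {ffun J -> K}) : {ffun I + J -> K} :=
  [ffun p => match p with inl i => u i | inr j => v j end].

Lemma nondegenerateP K I J (V : {ffun I -> K + J}) :
  reflect (forall j, exists i, V i = inr j) (nondegenerate V).
Proof.
apply: (iffP forallP) => H j; have := H j.
  by move=> /existsP[i /eqP]; exists i.
by move=> [i Vi]; apply/existsP; exists i; rewrite Vi.
Qed.

Lemma is_lineP K I (y : {ffun I -> option K}) :
  reflect (exists i, y i = None) (is_line y).
Proof. by apply: (iffP existsP) => -[i /eqP]; exists i. Qed.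

Lemma line_point_subspace K I J (V : {ffun I -> K + J}) y a :
  line_point (subspace_point (lift_subspace V) y) a = subspace_point V (line_point y a).
Proof. by apply/ffunP => i; rewrite !ffunE; case: (V i) => // j; rewrite ffunE. Qed.

Lemma nondegenerate_lift K I J (V : {ffun I -> K + J}) : nondegenerate V ->
  nondegenerate (lift_subspace V).
Proof.
by move=> /nondegenerateP nV; apply/nondegenerateP => j; have [i Vi] := nV j;
  exists i; rewrite ffunE Vi.
Qed.

Lemma is_line_subspace K I J (V : {ffun I -> K + J}) y :
  nondegenerate V -> is_line y -> is_line (subspace_point (lift_subspace V) y).
Proof.
move=> /nondegenerateP nV /is_lineP[j yj]; apply/is_lineP.
by have [i Vi] := nV j; exists i; rewrite !ffunE Vi.
Qed.

Lemma subspace_point_inj K I J (V : {ffun I -> K + J}) : nondegenerate V ->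
  injective (subspace_point V).
Proof.
move=> /nondegenerateP nV u v /ffunP uv; apply/ffunP => j.
by have [i Vi] := nV j; have := uv i; rewrite !ffunE Vi.
Qed.

Lemma subspace_point_comp K I J L (V : {ffun I -> K + J}) (W : {ffun J -> K + L}) u :
  subspace_point (comp_subspace V W) u = subspace_point V (subspace_point W u).
Proof. by apply/ffunP => i; rewrite !ffunE; case: (V i) => // j; rewrite ffunE. Qed.

Lemma nondegenerate_comp K I J L (V : {ffun I -> K + J}) (W : {ffun J -> K + L}) :
  nondegenerate V -> nondegenerate W -> nondegenerate (comp_subspace V W).
Proof.
move=> /nondegenerateP nV /nondegenerateP nW; apply/nondegenerateP => l.
by have [j Wj] := nW l; have [i Vi] := nV j; exists i; rewrite ffunE Vi.
Qed.

Lemma word_join_bij K I J :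
  bijective (fun uv : {ffun I -> K} * {ffun J -> K} => word_join uv.1 uv.2).
Proof.
exists (fun w : {ffun I + J -> K} => ([ffun i => w (inl i)], [ffun j => w (inr j)])).
  by move=> [u v] /=; congr pair; apply/ffunP => i; rewrite !ffunE.
by move=> w; apply/ffunP => -[i|j]; rewrite !ffunE.
Qed.

Lemma avg_word_join (R : realFieldType) K I J (f : {ffun I + J -> K} -> R) :
  avg f = avg (fun u => avg (fun v => f (word_join u v))).
Proof. by rewrite (avg_bij f (word_join_bij K I J)) avg_pair. Qed.

Lemma word_gt0 K I : (0 < #|K|)%N -> (0 < #|{ffun I -> K}|)%N.
Proof. by rewrite card_ffun expn_gt0 => ->. Qed.

Lemma bij_of_card (T S : finType) : #|T| = #|S| -> exists f : T -> S, bijective f.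
Proof.
move=> TS; exists (fun x => enum_val (cast_ord TS (enum_rank x))).
exists (fun y => enum_val (cast_ord (esym TS) (enum_rank y))) => x.
  by rewrite enum_valK cast_ordK enum_rankK.
by rewrite enum_valK cast_ordKV enum_rankK.
Qed.

Definition relabel K I J L (V : {ffun I -> K + J}) (e : J -> L) : {ffun I -> K + L} :=
  [ffun i => match V i with inl c => inl c | inr j => inr (e j) end].

Lemma subspace_point_relabel K I J L (V : {ffun I -> K + J}) (e : J -> L) u :
  subspace_point (relabel V e) u = subspace_point V [ffun j => u (e j)].
Proof. by apply/ffunP => i; rewrite !ffunE; case: (V i) => // j; rewrite ffunE. Qed.

Lemma nondegenerate_relabel K I J L (V : {ffun I -> K + J}) (e : J -> L) :
  bijective e -> nondegenerate V -> nondegenerate (relabel V e).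
Proof.
move=> [e' eK e'K] /nondegenerateP nV; apply/nondegenerateP => l.
by have [i Vi] := nV (e' l); exists i; rewrite ffunE Vi e'K.
Qed.

End Words.

(** * Ramsey theorems for lines *)

Section Ramsey.

Implicit Types K I J L N : finType.

(** Statements about finite types that are invariant under bijections can be proved
by adding one element at a time. *)
Lemma finType_ind (P : finType -> Prop) :
  (forall J L (e : J -> L), bijective e -> P J -> P L) ->
  P void -> (forall J, P J -> P (option J)) -> forall J, P J.
Proof.
move=> Pbij P0 PS J.
suff H n : exists2 L : finType, #|L| = n & P L.
  by have [L /bij_of_card[e be] PL] := H #|J|; exact: Pbij be PL.
elim: n => [|n [L Ln PL]]; first by exists void => //; rewrite card_void.
by exists (option L); [rewrite card_option Ln | exact: PS].
Qed.

(** The product of a line and a subspace is a subspace of one more dimension, the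
parameter [None] being the wildcard of the line. *)
Definition line_join K I1 I2 J (y : {ffun I1 -> option K}) (V : {ffun I2 -> K + J}) :
    {ffun I1 + I2 -> K + option J} :=
  [ffun p => match p with
    | inl i => if y i is Some c then inl c else inr None
    | inr i => match V i with inl c => inl c | inr j => inr (Some j) end end].

Lemma subspace_point_line_join K I1 I2 J (y : {ffun I1 -> option K}) (V :
  {ffun I2 -> K + J}) u :
  subspace_point (line_join y V) u = word_join (line_point y (u None)) (subspace_point
    V [ffun j => u (Some j)]).
Proof.
apply/ffunP => -[i|i]; rewrite !ffunE; first by case: (y i).
by case: (V i) => // j; rewrite ffunE.
Qed.

Lemma subspace_point_lift_line_join K I1 I2 J (y : {ffun I1 -> option K}) (V :
  {ffun I2 -> K + J}) u :
  subspace_point (lift_subspace (line_join y V)) u =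
  word_join (if u None is Some a then lift_word (line_point y a) else y)
       (subspace_point (lift_subspace V) [ffun j => u (Some j)]).
Proof.
apply/ffunP => -[i|i]; rewrite !ffunE.
  by case E : (u None) => [a|]; rewrite ?ffunE; case: (y i) => //=.
by case: (V i) => // j; rewrite ffunE.
Qed.

Lemma nondegenerate_line_join K I1 I2 J (y : {ffun I1 -> option K}) (V :
  {ffun I2 -> K + J}) :
  is_line y -> nondegenerate V -> nondegenerate (line_join y V).
Proof.
move=> /is_lineP[i yi] /nondegenerateP nV; apply/nondegenerateP => -[j|].
  by have [i' Vi'] := nV j; exists (inr i'); rewrite ffunE Vi'.
by exists (inl i); rewrite ffunE yi.
Qed.

(** The colouring form of the Hales-Jewett theorem. *)
Definition HJ K := forall C : finType, exists I : finType,
  forall chi : {ffun I -> K} -> C, exists2 y, is_line y &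
  forall a b, chi (line_point y a) = chi (line_point y b).

(** Among the [#|C| + 1] words [1...10...0] of length [#|C|] two have the same
colour, and the positions where they differ form the wildcard set. *)
Lemma HJ_bool : HJ bool.
Proof.
move=> C; exists 'I_#|C| => chi.
pose w (m : 'I_#|C|.+1) : {ffun 'I_#|C| -> bool} := [ffun p : 'I_#|C| => (p < m)%N].
have : ~~ injectiveb (fun m => chi (w m)).
  apply/negP => /injectiveP /leq_card.
  by rewrite card_ord ltnn.
rewrite /injectiveb => /injectivePn[m1 [m2 m12 chi12]].
wlog lt12 : m1 m2 m12 chi12 / (m1 < m2)%N.
  move=> H; have [lt12|lt21|eq12] := ltngtP m1 m2; first exact: (H m1 m2).
    by apply: (H m2 m1) => //; rewrite eq_sym.
  by move: m12; rewrite (val_inj eq12) eqxx.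
pose y : {ffun 'I_#|C| -> option bool} :=
  [ffun p : 'I_#|C| => if (p < m1)%N then Some true else if (p < m2)%N then None else Some false].
exists y.
  have m1C : (m1 < #|C|)%N by rewrite (leq_trans lt12)// -ltnS.
  by apply/is_lineP; exists (Ordinal m1C); rewrite ffunE /= ltnn lt12.
suff H a : chi (line_point y a) = chi (w m1) by move=> a b; rewrite !H.
have -> : line_point y a = if a then w m2 else w m1; last by case: a.
apply/ffunP => p; rewrite 2!ffunE; case: ifP => [pm1|pm1].
  by case: a; rewrite ffunE /= ?pm1// (ltn_trans pm1).
by case: ifP => pm2; case: a; rewrite ffunE /= ?pm1 ?pm2.
Qed.

(** The first block carries a line for the colouring of its words by the colourings
they induce on the remaining coordinates; the remaining coordinates are then
treated for one fixed value on that line. *)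
Lemma multidim_HJ K (a0 : K) : HJ K -> forall J C : finType, exists I : finType,
  forall chi : {ffun I -> K} -> C, exists2 V : {ffun I -> K + J}, nondegenerate V &
  forall u v, chi (subspace_point V u) = chi (subspace_point V v).
Proof.
move=> hj J C; elim/finType_ind: J => [J L e be [I H]||J [I2 H2]].
- exists I => chi; have [V nV HV] := H chi.
  by exists (relabel V e);
    [exact: nondegenerate_relabel | move=> u v; rewrite !subspace_point_relabel].
- exists void => chi; exists [ffun p : void => inr p]; first by apply/nondegenerateP;
  case.
  by move=> u v; congr (chi (subspace_point _ _)); apply/ffunP; case.
have [I1 H1] := hj {ffun {ffun I2 -> K} -> C}.
exists (I1 + I2)%type => chi.
have [y yl Hy] := H1 (fun w => [ffun v => chi (word_join w v)]).
have [V nV HV] := H2 (fun v => chi (word_join (line_point y a0) v)).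
exists (line_join y V); first exact: nondegenerate_line_join.
suff H u : chi (subspace_point (line_join y V) u) = chi (word_join (line_point y a0)
  (subspace_point V [ffun j => u (Some j)])).
  by move=> u v; rewrite !H; exact: HV.
rewrite subspace_point_line_join.
by have /ffunP/(_ (subspace_point V [ffun j => u (Some j)])) := Hy (u None) a0;
  rewrite !ffunE.
Qed.

(** A map [N -> option J] onto [Some j] for all [j] is a family of disjoint nonempty
subsets of [N] indexed by [J], and [unions V b] is the union of those selected
by [b]. *)
Definition unions N J (V : {ffun N -> option J}) (b : {ffun J -> bool}) :
  {ffun N -> bool} :=
  [ffun i => if V i is Some j then b j else false].

Definition mono_unions N J (chi : {ffun N -> bool} -> bool) (c : bool) :=
  exists2 V : {ffun N -> option J}, forall j, exists i, V i = Some j &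
  forall b : {ffun J -> bool}, (exists j, b j) -> chi (unions V b) = c.

Lemma mono_unions_bij N J L (e : J -> L) chi c :
  bijective e -> @mono_unions N J chi c -> @mono_unions N L chi c.
Proof.
move=> [e' eK e'K] [V sV HV]; exists [ffun i => omap e (V i)].
  by move=> l; have [i Vi] := sV (e' l); exists i; rewrite ffunE Vi /= e'K.
move=> b [l bl]; rewrite -(HV [ffun j => b (e j)]); last by exists (e' l);
  rewrite ffunE e'K.
by congr chi; apply/ffunP => i; rewrite !ffunE; case: (V i) => //= j; rewrite ffunE.
Qed.

Lemma mono_unions_joinl N1 N2 J (chi : {ffun N1 + N2 -> bool} -> bool) c :
  mono_unions J (fun u => chi (word_join u [ffun=> false])) c -> mono_unions J chi c.
Proof.
move=> [V sV HV]; exists [ffun p => if p is inl i then V i else None].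
  by move=> j; have [i Vi] := sV j; exists (inl i); rewrite ffunE.
move=> b /HV <-; congr chi; apply/ffunP => -[i|i]; rewrite !ffunE//.
Qed.

Lemma mono_unions_joinr N1 N2 J (chi : {ffun N1 + N2 -> bool} -> bool) c :
  mono_unions J (fun u => chi (word_join [ffun=> false] u)) c -> mono_unions J chi c.
Proof.
move=> [V sV HV]; exists [ffun p => if p is inr i then V i else None].
  by move=> j; have [i Vi] := sV j; exists (inr i); rewrite ffunE.
move=> b /HV <-; congr chi; apply/ffunP => -[i|i]; rewrite !ffunE//.
Qed.

Definition word_cons N T (b : T) (w : {ffun N -> T}) : {ffun option N -> T} :=
  [ffun o => if o is Some p then w p else b].

(** Coordinates that are constantly [true] in [U] join the set of the new element
of [option N]; they disappear when that set is not selected. *)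
Definition erase_true N J (U : {ffun N -> bool + J}) : {ffun N -> bool + J} :=
  [ffun i => if U i is inr j then inr j else inl false].

Lemma mono_unions_erase N J L (U : {ffun N -> bool + J}) chi c : nondegenerate U ->
  mono_unions L (fun u =>
    chi (word_cons false (subspace_point (erase_true U) u))) c -> mono_unions L chi c.
Proof.
move=> /nondegenerateP nU [V sV HV].
exists [ffun o => if o is Some p then (if U p is inr j then V j else None) else None].
  move=> l; have [j Vj] := sV l; have [p Up] := nU j.
  by exists (Some p); rewrite ffunE Up.
move=> b /HV <-; congr chi; apply/ffunP => -[p|]; rewrite !ffunE//.
by case: (U p) => // j; rewrite ffunE.
Qed.

(** The new element of [option N] together with the constants [true] of [U] forms
an additional set.  Unions containing it have colour [c] by the hypothesis on
[U], the others by the hypothesis on the smaller family. *)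
Lemma mono_unions_cons N J L (U : {ffun N -> bool + J}) chi c : nondegenerate U ->
  (forall u, chi (word_cons true (subspace_point U u)) = c) ->
  mono_unions L (fun u =>
    chi (word_cons false (subspace_point (erase_true U) u))) c ->
    mono_unions (option L) chi c.
Proof.
move=> /nondegenerateP nU Uc [V sV HV].
exists [ffun o => if o is Some p then
    match U p with
    | inl true => Some None | inl false => None | inr j => omap Some (V j) end
  else Some None].
  move=> [l|]; last by exists None; rewrite ffunE.
  have [j Vj] := sV l; have [p Up] := nU j.
  by exists (Some p); rewrite ffunE Up Vj.
move=> b [l bl]; pose b' := [ffun j => b (Some j)].
case E : (b None).
  rewrite -(Uc (unions V b')); congr chi.
  apply/ffunP => -[p|]; rewrite !ffunE//.
  case: (U p) => [[|]//|j]; rewrite ffunE.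
  by case: (V j) => //= l'; rewrite ffunE.
rewrite -(HV b'); last by case: l bl => [l bl|]; [exists l; rewrite ffunE | rewrite E].
congr chi; apply/ffunP => -[p|]; rewrite !ffunE//.
case: (U p) => [[|]//|j]; rewrite ffunE.
by case: (V j) => //= l'; rewrite ffunE.
Qed.

(** An asymmetric form of the finite unions theorem (Folkman, Rado, Sanders), by
induction on both numbers of sets.  The Hales-Jewett theorem for two letters
makes the colour constant on the sets containing the new element; according to
this colour one of the two families is extended by one set. *)
Lemma finite_unions J0 J1 : exists N, forall chi : {ffun N -> bool} -> bool,
  mono_unions J0 chi false \/ mono_unions J1 chi true.
Proof.
have mono_unions_void N chi c : @mono_unions N void chi c.
  by exists [ffun=> None]; [case | move=> b [[]]].
elim/finType_ind: J0 J1 => [J L e be IH J1||J0 IH J1].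
- have [N H] := IH J1; exists N => chi.
  by have [/(mono_unions_bij be)|] := H chi; [left|right].
- by move=> J1; exists unit => chi; left.
elim/finType_ind: J1 => [J L e be [N H]||J1 [N1 H1]].
- by exists N => chi; have [|/(mono_unions_bij be)] := H chi; [left|right].
- by exists unit => chi; right.
have [N2 H2] := IH (option J1).
have [N HN] := multidim_HJ true HJ_bool (N1 + N2)%type bool.
exists (option N) => chi.
have [U nU HU] := HN (fun w => chi (word_cons true w)).
pose c := chi (word_cons true (subspace_point U [ffun=> false])).
have {}HU u : chi (word_cons true (subspace_point U u)) = c by exact: HU.
pose chi0 (u : {ffun N1 + N2 -> bool}) := chi (word_cons false (subspace_point
  (erase_true U) u)).
case cE : c in HU; last first.
  have [/(@mono_unions_joinr _ _ _ chi0)|/(@mono_unions_joinr _ _ _ chi0)] := H2 (fun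
    u => chi0 (word_join [ffun=> false] u)).
    by left; exact: mono_unions_cons HU _.
  by right; exact: mono_unions_erase nU _.
have [/(@mono_unions_joinl _ _ _ chi0)|/(@mono_unions_joinl _ _ _ chi0)] := H1 (fun u
  => chi0 (word_join u [ffun=> false])).
  by left; exact: mono_unions_erase nU _.
by right; exact: mono_unions_cons HU _.
Qed.

(** Each coordinate of the subspace is a line of its own block, chosen so that the
colour is not affected by its value in [K] whatever the letters of the later
blocks are.  The colours of the later blocks then form a pair, one component for
the wildcard and one for a letter of [K]. *)
Lemma wildcard_dependence K (a0 : K) : HJ K -> forall J C : finType, exists I : finType,
  forall chi : {ffun I -> option K} -> C, exists2 V : {ffun I -> K + J}, nondegenerate V &
  forall y y' : {ffun J -> option K}, (forall j, (y j == None) = (y' j == None)) ->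
    chi (subspace_point (lift_subspace V) y) = chi (subspace_point (lift_subspace V) y').
Proof.
move=> hj J; elim/finType_ind: J => [J L e be IH C||J IH C].
- have [I H] := IH C; exists I => chi; have [V nV HV] := H chi.
  exists (relabel V e); first exact: nondegenerate_relabel.
  have rE y : subspace_point (lift_subspace (relabel V e)) y = subspace_point
    (lift_subspace V) [ffun j => y (e j)].
    by rewrite -subspace_point_relabel; congr subspace_point; apply/ffunP => i;
      rewrite !ffunE; case: (V i).
  by move=> y y' yy'; rewrite !rE; apply: HV => j; rewrite !ffunE.
- exists void => chi; exists [ffun p : void => inr p]; first by apply/nondegenerateP;
  case.
  by move=> u v _; congr (chi (subspace_point _ _)); apply/ffunP; case.
have [I2 H2] := IH (C * C)%type.
have [I1 H1] := hj {ffun {ffun I2 -> option K} -> C}.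
exists (I1 + I2)%type => chi.
have [y yl Hy] := H1 (fun w => [ffun v => chi (word_join (lift_word w) v)]).
have [V nV HV] := H2 (fun v =>
  (chi (word_join y v), chi (word_join (lift_word (line_point y a0)) v))).
exists (line_join y V); first exact: nondegenerate_line_join.
move=> u u' uu'; rewrite !subspace_point_lift_line_join.
have Hs a v : chi (word_join (lift_word (line_point y a)) v) = chi (word_join
  (lift_word (line_point y a0)) v).
  by have /ffunP/(_ v) := Hy a a0; rewrite !ffunE.
have Hj j : ([ffun j => u (Some j)] j == None) = ([ffun j => u' (Some j)] j == None).
  by rewrite !ffunE uu'.
have HVu := HV [ffun j => u (Some j)] [ffun j => u' (Some j)].
have [HV1 HV2] := HVu Hj.
have := uu' None; case: (u None) => [a|]; case: (u' None) => [a'|] //= _.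
by rewrite Hs [RHS]Hs.
Qed.

(** The Graham-Rothschild theorem for lines and two colours.  By
[wildcard_dependence] the colour of a line becomes a function of its wildcard
set, to which the finite unions theorem applies. *)
Lemma line_ramsey K (a0 : K) : HJ K -> forall J0 J1, exists M : finType,
  forall chi : {ffun M -> option K} -> bool,
    (exists2 V : {ffun M -> K + J0}, nondegenerate V &
       forall y, is_line y -> ~~ chi (subspace_point (lift_subspace V) y)) \/
    (exists2 V : {ffun M -> K + J1}, nondegenerate V &
       forall y, is_line y -> chi (subspace_point (lift_subspace V) y)).
Proof.
move=> hj J0 J1; have [N HN] := finite_unions J0 J1.
have [M HM] := wildcard_dependence a0 hj N bool.
exists M => chi; have [V nV HV] := HM chi.
pose word (b : {ffun N -> bool}) : {ffun N -> option K} :=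
  [ffun n => if b n then None else Some a0].
have aux J c : mono_unions J (fun b =>
  chi (subspace_point (lift_subspace V) (word b))) c ->
   exists2 V' : {ffun M -> K + J}, nondegenerate V' &
     forall y, is_line y -> chi (subspace_point (lift_subspace V') y) = c.
  move=> [W sW HW].
  pose W' : {ffun N -> K + J} := [ffun n => if W n is Some j then inr j else inl a0].
  have nW' : nondegenerate W'.
    by apply/nondegenerateP => j; have [n Wn] := sW j; exists n; rewrite ffunE Wn.
  exists (comp_subspace V W'); first exact: nondegenerate_comp.
  move=> y /is_lineP[j yj]; rewrite -(HW [ffun j => y j == None]); last first.
    by exists j; rewrite ffunE yj.
  have -> : lift_subspace (comp_subspace V W') = comp_subspace (lift_subspace V)
    (lift_subspace W').
    by apply/ffunP => i; rewrite !ffunE; case: (V i) => [c0|n] /=; rewrite ?ffunE.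

  rewrite subspace_point_comp; apply: HV => n; rewrite !ffunE.
  by case: (W n) => //= j'; rewrite ffunE; case: (y j').
have [/aux[V' nV' H]|/aux[V' nV' H]] := HN (fun b =>
  chi (subspace_point (lift_subspace V) (word b))).
  by left; exists V' => // y /H ->.
by right; exists V' => // y /H ->.
Qed.

End Ramsey.

(** * Two consequences of the archimedean property *)

Section Archimedean.
Context {R : archiRealFieldType}.

(** Bernoulli's inequality in the form [x ^+ n * (1 + n * (1 - x)) <= 1]. *)
Lemma expr_small (x e : R) : 0 <= x -> x < 1 -> 0 < e -> exists n, x ^+ n < e.
Proof.
move=> x0 x1 e0; pose h := 1 - x; have h0 : 0 < h by rewrite subr_gt0.
have bern n : x ^+ n * (1 + n%:R * h) <= 1.
  elim: n => [|n IH]; first by rewrite mul0r addr0 mulr1.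
  apply: le_trans IH; rewrite exprSr -mulrA ler_wpM2l ?exprn_ge0//.
  have n0 : (0 : R) <= n%:R by exact: ler0n.
  have -> : x = 1 - h by rewrite /h; ring.
  by rewrite -natr1; nra.
have eh0 : 0 <= e^-1 / h by rewrite divr_ge0// ?invr_ge0 ltW.
exists (Num.bound (e^-1 / h)).
have := archi_boundP eh0; set n := Num.bound _.
rewrite ltr_pdivrMr// => nh.
have e1 : 1 < e * (1 + n%:R * h).
  rewrite -(ltr_pM2l e0) mulfV ?gt_eqF// in nh.
  by nra.
have q0 : 0 < 1 + n%:R * h by have := ler0n R n; nra.
by rewrite -(ltr_pM2r q0); apply: le_lt_trans (bern n) _.
Qed.

Lemma descent (P : R -> Prop) (a b c : R) : 0 < c ->
  (forall x y, x <= y -> P x -> P y) ->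
  (forall x, a <= x -> x <= b -> P (x + c) -> P x) -> a <= b -> P b -> P a.
Proof.
move=> c0 Pmono Pstep ab Pb.
have H n x : a <= x -> x <= b -> b <= x + n%:R * c -> P x.
  elim: n x => [|n IH] x ax xb; first by rewrite mul0r addr0 => bx; exact: Pmono bx Pb.
  rewrite -natr1 mulrDl mul1r addrA => bx; apply: Pstep => //.
  have [xcb|bxc] := leP (x + c) b; last exact: Pmono (ltW bxc) Pb.
  by apply: IH => //; lra.
have bac : 0 <= (b - a) / c by rewrite divr_ge0 ?subr_ge0// ltW.
apply: (H (Num.bound ((b - a) / c)) a) => //.
have := archi_boundP bac; rewrite ltr_pdivrMr//; lra.
Qed.

End Archimedean.

(** * The density statement and subspaces over a smaller alphabet *)

Section DensityHalesJewett.
Context {R : archiRealFieldType}.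
Implicit Types K I J N : finType.

Definition DHJ_at K I (delta : R) := forall A : pred {ffun I -> K}, delta <= density A ->
  exists2 y, is_line y & forall a, A (line_point y a).

Definition DHJ K := forall delta : R, 0 < delta ->
  exists n, forall I, (n <= #|I|)%N -> DHJ_at K I delta.

(** By averaging, some choice of the extra coordinates gives a section which is at
least as dense. *)
Lemma DHJ_at_larger K I0 I delta : (0 < #|K|)%N -> (#|I0| <= #|I|)%N ->
  DHJ_at K I0 delta -> DHJ_at K I delta.
Proof.
move=> K0 I0I H A dA.
have cE : #|{: I0 + 'I_(#|I| - #|I0|)}| = #|I|.
  by rewrite card_sum card_ord subnKC.
have [e [e' eK e'K]] := bij_of_card cE.
pose h (w : {ffun I0 + 'I_(#|I| - #|I0|) -> K}) : {ffun I -> K} := [ffun i => w (e' i)].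
have bh : bijective h.
  exists (fun w : {ffun I -> K} => [ffun p => w (e p)]) => w.
    by apply/ffunP => p; rewrite !ffunE eK.
  by apply/ffunP => p; rewrite !ffunE e'K.
move: dA; rewrite /density (avg_bij _ bh) avg_word_join avg_exchange => dA.
have [z] := avg_le_ex (word_gt0 _ K0) dA.
move=> /(H (fun u => A (h (word_join u z))))[y /is_lineP[p yp] Hy].
exists [ffun i => match e' i with inl p => y p | inr q => Some (z q) end].
  by apply/is_lineP; exists (e (inl p)); rewrite ffunE eK.
move=> a; have := Hy a; congr (is_true (A _)); apply/ffunP => i.
by rewrite !ffunE; case: (e' i) => q; rewrite ?ffunE.
Qed.

Lemma DHJ_of_ex K : (0 < #|K|)%N ->
  (forall delta, 0 < delta -> exists I, DHJ_at K I delta) -> DHJ K.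
Proof.
move=> K0 H delta /H[I0 HI0]; exists #|I0| => I I0I.
exact: DHJ_at_larger HI0.
Qed.

Lemma DHJ_HJ K : (0 < #|K|)%N -> DHJ K -> HJ K.
Proof.
move=> K0 dhj C.
have C0 : (0 : R) < #|C|.+1%:R^-1 by rewrite invr_gt0 ltr0n.
have [n Hn] := dhj _ C0; exists 'I_n => chi.
have [//||c] := @popular_witness R {ffun 'I_n -> K} C predT (fun w c =>
  chi w == c) 1 ltr01.
- by rewrite /density avg_cst// word_gt0.
- by move=> w _; exists (chi w).
move=> Hc; have : #|C|.+1%:R^-1 <= density (fun w => chi w == c) :> R.
  apply: le_trans Hc; rewrite div1r lef_pV2 ?posrE ?ltr0n ?ler_nat//.
  by apply/card_gt0P; exists c.
case/Hn; first by rewrite card_ord.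
move=> y yl Hy; exists y => // a b.
by rewrite (eqP (Hy a)) (eqP (Hy b)).
Qed.

Section SupportFibers.
Context {K N : finType}.
Hypothesis K0 : (0 < #|K|)%N.

Definition letter_support (y : {ffun N -> option K}) : {set N} := [set p | y p != None].

Definition extend_word (S : {set N}) (w : {ffun {p : N | p \in S} -> K}) :
    {ffun N -> option K} :=
  [ffun p => omap w (insub p)].

Lemma sum_support_fiber (S : {set N}) (F : {ffun N -> option K} -> R) :
  \sum_(y | letter_support y == S) F y = \sum_(w : {ffun {p : N | p \in S} -> K}) F
    (extend_word w).
Proof.
have /card_gt0P[a0 _] := K0.
rewrite (reindex_onto (@extend_word S)
  (fun y : {ffun N -> option K} =>
    [ffun q : {p : N | p \in S} => odflt a0 (y (val q))])) /=.
  apply: eq_bigl => w; apply/andP; split.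
    apply/eqP/setP => p; rewrite inE ffunE.
    by case: insubP => [q qS _|/negPf ->] //=; rewrite qS.
  by apply/eqP/ffunP => q; rewrite !ffunE valK.
move=> y /eqP yS; apply/ffunP => p; rewrite ffunE.
have : (p \in S) = (y p != None) by rewrite -yS inE.
case: insubP => [q -> <- /=|/negPf -> /=]; first by rewrite ffunE; case: (y _).
by case: (y p).
Qed.

(** A word with fewer than [n] letters in [K] satisfies
[1 <= 2 ^ n * 2 ^ - #|letter_support y|], and the sum of the right hand sides is a
product over the coordinates. *)
Lemma few_small_supports n :
  density (fun y : {ffun N -> option K} =>
    #|letter_support y| < n)%N <= 2 ^+ n * (3 / 4) ^+ #|N| :> R.
Proof.
pose wt (o : option K) : R := if o is None then 1 else 2^-1.
have h y : (#|letter_support y| < n)%N%:R <= 2 ^+ n * \prod_p wt (y p) :> R.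
  have -> : \prod_p wt (y p) = 2^-1 ^+ #|letter_support y| :> R.
    rewrite -prodr_const [RHS]big_mkcond; apply: eq_bigr => p _.
    by rewrite inE; case: (y p).
  case: ltnP => /= hn; last by rewrite mulr_ge0 ?exprn_ge0 ?invr_ge0 ?ler0n.
  rewrite exprVn ler_pdivlMr ?exprn_gt0 ?ltr0n// mul1r.
  by rewrite ler_weXn2l ?ler1n// ltnW.
apply: le_trans (le_avg h) _; rewrite avgZ ler_wpM2l ?exprn_ge0 ?ler0n//.
rewrite /avg -(bigA_distr_bigA (fun _ => wt)) /= prodr_const card_ffun natrX.
rewrite -expr_div_n lerXn2r ?nnegrE ?divr_ge0 ?ler0n ?sumr_ge0//.
  by move=> [a|] _; rewrite /wt ?invr_ge0 ?ler0n ?ler01.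
rewrite card_option ler_pdivrMr ?ltr0n// (bigD1 None)//=.
rewrite (eq_bigr (fun=> 2^-1)); last by case.
have -> : \sum_(i : option K | i != None) (2^-1 : R) = #|K|%:R / 2.
  rewrite sumr_const -[_ *+ _]mulr_natl; congr (_%:R * _).
  by rewrite -[#|K|]/(#|K|.+1.-1) -card_option -(cardC1 (None : option K)).
have : (1 : R) <= #|K|%:R by rewrite ler1n.
by rewrite -[#|K|.+1%:R]natr1 /wt; lra.
Qed.

End SupportFibers.

(** Split the cube over [option K] according to the positions of the letter [None].
Most words have many letters in [K], so one of the parts with many free
positions is dense, and this part is a cube over [K]. *)
Lemma dense_line K : (0 < #|K|)%N -> DHJ K -> forall beta : R, 0 < beta ->
  exists N, forall E : pred {ffun N -> option K}, beta <= density E ->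
  exists2 y : {ffun N -> option (option K)}, is_line y & forall a,
    E (line_point y (Some a)).
Proof.
move=> K0 dhj beta beta0.
have b20 : 0 < beta / 2 by rewrite divr_gt0// ltr0n.
have [n Hn] := dhj _ b20.
have e0 : 0 < beta / 2 / 2 ^+ n by rewrite divr_gt0// exprn_gt0// ltr0n.
have [m Hm] : exists m, (3 / 4 : R) ^+ m < beta / 2 / 2 ^+ n.
  by apply: expr_small e0; lra.
exists 'I_m => E dE.
suff : [exists y : {ffun 'I_m -> option (option K)},
  is_line y && [forall a, E (line_point y (Some a))]].
  by move=> /existsP[y /andP[yl /forallP Hy]]; exists y.
apply: contraLR dE => noline; rewrite -ltNge.
have few := @few_small_supports K 'I_m K0 n; rewrite card_ord in few.
suff : density E <= beta / 2 + density (fun y : {ffun 'I_m -> option K} =>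
  #|letter_support y| < n)%N.
  move=> h; apply: le_lt_trans h _.
  move: Hm; rewrite ltr_pdivlMr ?exprn_gt0 ?ltr0n// mulrC; lra.
rewrite -[X in X + _](avg_cst (T := {ffun 'I_m -> option K})); last first.
  by rewrite word_gt0// card_option.
rewrite -avgD /density /avg ler_wpM2r ?invr_ge0 ?ler0n//.
rewrite (partition_big letter_support xpredT)//= [leRHS](partition_big letter_support
  xpredT)//=.
apply: ler_sum => S _; rewrite !sum_support_fiber//.
have [nS|Sn] := leqP n #|S|; last first.
  apply: ler_sum => w _.
  have -> : (#|letter_support (extend_word w)| < n)%N.
    suff -> : letter_support (extend_word w) = S by [].
    apply/setP => p; rewrite inE ffunE.
    by case: insubP => [q qS _|/negPf ->] //=; rewrite qS.
  by rewrite /=; case: (E _) => /=; lra.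
apply: (@le_trans _ _ (\sum_(w : {ffun {p : 'I_m | p \in S} -> K}) (beta / 2)));
  last first.
  by apply: ler_sum => w _; rewrite lerDl ler0n.
have W0 : (0 : R) < #|{ffun {p : 'I_m | p \in S} -> K}|%:R by rewrite ltr0n word_gt0.
rewrite sumr_const -[_ *+ _]mulr_natr -ler_pdivrMr//.
rewrite -/(avg (fun w : {ffun {p : 'I_m | p \in S} -> K} =>
  (E (extend_word w))%:R)) leNgt.
apply/negP => /ltW /Hn[]; first by rewrite card_sig.
move=> y /is_lineP[q yq] Hy; move/existsPn: noline => /(_ [ffun p =>
  if insub p is Some q then omap Some (y q) else Some None]).
apply/negP; rewrite negbK; apply/andP; split.
  by apply/is_lineP; exists (val q); rewrite ffunE valK yq.
apply/forallP => a; have := Hy a; congr (is_true (E _)).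
apply/ffunP => p; rewrite !ffunE; case: insubP => [r _ _|_] //=.
by rewrite ffunE; case: (y r).
Qed.

(** By induction on the dimension: for many values of the remaining coordinates the section over the first block
contains a line, one line occurs for a positive proportion of these values, and
the set of these values is again dense. *)
Lemma dense_subspace K : (0 < #|K|)%N -> DHJ K -> forall J (beta : R), 0 < beta ->
  exists N, forall E : pred {ffun N -> option K}, beta <= density E ->
  exists2 V : {ffun N -> option K + J}, nondegenerate V & forall u,
    E (subspace_point V (lift_word u)).
Proof.
move=> K0 dhj J; elim/finType_ind: J => [J L e be IH beta b0|beta b0|J IH beta b0].
- have [N H] := IH beta b0; exists N => E /H[V nV HV].
  exists (relabel V e); first exact: nondegenerate_relabel.
  move=> u; have := HV [ffun j => u (e j)]; congr (is_true (E _)).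
  by rewrite subspace_point_relabel; congr subspace_point; apply/ffunP => j;
    rewrite !ffunE.
- exists void => E bE.
  have oK0 : (0 < #|{: option K}|)%N by rewrite card_option.
  have [w] := avg_lt_ex (word_gt0 _ oK0) (lt_le_trans b0 bE).
  rewrite ltr0n lt0b => Ew.
  exists [ffun p : void => inr p]; first by apply/nondegenerateP; case.
  by move=> u; congr (is_true (E _)): Ew; apply/ffunP; case.
have b20 : 0 < beta / 2 by rewrite divr_gt0// ltr0n.
have [N1 H1] := dense_line K0 dhj b20.
pose L := {ffun N1 -> option (option K)} : finType.
have L0 : (0 < #|L|)%N by rewrite word_gt0// card_option.
have b'0 : 0 < beta / 2 / #|L|%:R by rewrite divr_gt0// ltr0n.
have [N2 H2] := IH _ b'0.
exists (N1 + N2)%type => E; rewrite /density avg_word_join avg_exchange => bE.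
pose rel v (y : L) := is_line y && [forall a, E (word_join (line_point y (Some a)) v)].
have [|v|y Hy] := @popular_witness R _ _ _ rel _ b20 (avg_half (ltW b0) _ bE).
- by move=> v; exact: density_le1.
- move=> /(H1 (fun u => E (word_join u v)))[y yl Hy].
  by exists y; rewrite /rel yl; apply/forallP.
have [V nV HV] := H2 _ Hy.
have /card_gt0P[a0 _] := K0.
have /andP[yl _] := HV [ffun=> a0].
exists (line_join y V); first exact: nondegenerate_line_join.
move=> u; have /andP[_ /forallP/(_ (u None))] := HV [ffun j => u (Some j)].
congr (is_true (E _)); rewrite subspace_point_line_join ffunE;
  congr (word_join _ (subspace_point _ _)).
by apply/ffunP => j; rewrite !ffunE.
Qed.

End DensityHalesJewett.

(** * Density increments on insensitive sets *)

Section Increment.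
Context {R : archiRealFieldType}.
Implicit Types K I J N : finType.

Lemma line_point_join K I J (y : {ffun I -> option K}) (z : {ffun J -> option K}) a :
  line_point (word_join y z) a = word_join (line_point y a) (line_point z a).
Proof. by apply/ffunP => -[i|i]; rewrite !ffunE. Qed.

Lemma line_point_lift_word K I (w : {ffun I -> K}) a : line_point (lift_word w) a = w.
Proof. by apply/ffunP => i; rewrite !ffunE. Qed.

Lemma line_point_cons K I (y : {ffun I -> option K}) a :
  line_point (word_cons None y) a = word_cons a (line_point y a).
Proof. by apply/ffunP => -[i|]; rewrite !ffunE. Qed.

(** The letters [None] and [Some a] cannot be distinguished by [E]. *)
Definition insensitive K I (a : K) (E : pred {ffun I -> option K}) :=
  forall y y', line_point y a = line_point y' a -> E y = E y'.

Definition prefix_subspace K I1 I2 J (u : {ffun I1 -> K}) (V : {ffun I2 -> K + J}) :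
    {ffun I1 + I2 -> K + J} :=
  [ffun p => match p with inl i => inl (u i) | inr i => V i end].

Definition suffix_subspace K I1 I2 J (V : {ffun I1 -> K + J}) (v : {ffun I2 -> K}) :
    {ffun I1 + I2 -> K + J} :=
  [ffun p => match p with inl i => V i | inr i => inl (v i) end].

Lemma subspace_point_prefix K I1 I2 J u V w : subspace_point (@prefix_subspace K I1 I2
  J u V) w = word_join u (subspace_point V w).
Proof. by apply/ffunP => -[i|i]; rewrite !ffunE. Qed.

Lemma subspace_point_suffix K I1 I2 J V v w : subspace_point (@suffix_subspace K I1 I2
  J V v) w = word_join (subspace_point V w) v.
Proof. by apply/ffunP => -[i|i]; rewrite !ffunE. Qed.

Lemma nondegenerate_prefix K I1 I2 J u V : nondegenerate V ->
  nondegenerate (@prefix_subspace K I1 I2 J u V).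
Proof.
move=> /nondegenerateP nV; apply/nondegenerateP => j; have [i Vi] := nV j.
by exists (inr i); rewrite ffunE.
Qed.

Lemma nondegenerate_suffix K I1 I2 J V v : nondegenerate V ->
  nondegenerate (@suffix_subspace K I1 I2 J V v).
Proof.
move=> /nondegenerateP nV; apply/nondegenerateP => j; have [i Vi] := nV j.
by exists (inl i); rewrite ffunE.
Qed.

Lemma avg_image (S T : finType) (h : S -> T) (f : T -> R) :
  (0 < #|S|)%N -> injective h ->
  avg (fun y => f y * (y \in h @: [set: S])%:R) =
  #|S|%:R / #|T|%:R * avg (fun x => f (h x)).
Proof.
move=> S0 hI; rewrite /avg [RHS]mulrC mulrA divfK ?pnatr_eq0 -?lt0n//.
congr (_ / _).
transitivity (\sum_(x in [set: S]) f (h x)); last by apply: eq_bigl => x; rewrite inE.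
rewrite -big_imset => [/=|]; last exact: in2W.
rewrite [RHS]big_mkcond; apply: eq_bigr => y _.
by case: (y \in _); rewrite ?mulr1 ?mulr0.
Qed.

Section OptionStep.
Context {K : finType}.
Hypotheses (K0 : (0 < #|K|)%N) (dhj : @DHJ R K).

Notation W I := ({ffun I -> option K} : finType).

Let oK0 : (0 < #|{: option K}|)%N. Proof. by rewrite card_option. Qed.

(** By [dense_subspace] every section of [E] over a block that is dense contains a
subspace over [K], hence over [option K] by insensitivity.  Remove these
subspaces, on which [g] may be assumed to have average at most 0.  The average
of [g] over the set does not decrease, and the density of the set decreases by
a constant proportion of its excess over [beta / 2].  After boundedly many
rounds the set has density at most [beta], contradicting [g <= 1]. *)
Lemma insensitive_increment J (beta : R) : 0 < beta -> exists Y : finType,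
  forall a (E : pred {ffun Y -> option K}) (g : {ffun Y -> option K} -> R),
  insensitive a E -> (forall y, g y <= 1) -> beta < avg (fun y => g y * (E y)%:R) ->
  exists2 V : {ffun Y -> option K + J}, nondegenerate V & 0 < avg (fun u =>
    g (subspace_point V u)).
Proof.
move=> beta0; have [beta1|beta1] := ltP 1 beta.
  exists void => a E g _ g1 bg; exfalso; move: bg; apply/negP; rewrite -leNgt.
  apply: le_trans (ltW beta1); rewrite -[leRHS](avg_cst (T := W void)) ?word_gt0//.
  by apply: le_avg => y; case: (E y); rewrite ?mulr1 ?mulr0.
have b20 : 0 < beta / 2 by rewrite divr_gt0// ltr0n.
have [N HN] := dense_subspace K0 dhj J b20.
pose c : R := #|W J|%:R / #|W N|%:R.
have c0 : 0 < c by rewrite divr_gt0// ltr0n word_gt0.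
have c1 : c <= 1.
  have [|V nV _] := HN predT.
    by rewrite /density avg_cst ?word_gt0//; lra.
  by rewrite ler_pdivrMr ?ltr0n ?word_gt0//
    mul1r ler_nat (leq_card _ (subspace_point_inj nV)).
(* The factor [(1 - c) ^+ j] bounds the excess density left after [j] rounds. *)
have claim j : exists Y : finType,
  forall a (E : pred {ffun Y -> option K}) (g : {ffun Y -> option K} -> R),
  insensitive a E -> (forall y, g y <= 1) ->
  beta / 2 + (1 - c) ^+ j * (density E - beta / 2) < avg (fun y => g y * (E y)%:R) ->
  exists2 V : {ffun Y -> option K + J}, nondegenerate V & 0 < avg (fun u =>
    g (subspace_point V u)).
  elim: j => [|j [Y IH]].
    exists void => a E g _ g1; rewrite expr0 mul1r addrC subrK ltNge => /negP[].
    by apply: le_avg => y; case: (E y); rewrite ?mulr1 ?mulr0.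
  exists (N + Y)%type => a E g Ea g1 big.
  pose inside (z : W Y) (V : {ffun N -> option K + J}) :=
    nondegenerate V && [forall u, E (word_join (subspace_point V u) z)].
  (* Choosing the subspace as a function of the section of [E] at [z] alone
     keeps the remaining set insensitive in [z]. *)
  pose pk z := [pick V | inside z V].
  pose hit (z : W Y) (y : W N) := if pk z is Some V then y \in subspace_point V @:
    [set: W J] else false.
  pose E' (y : W N) (z : W Y) := E (word_join y z) && ~~ hit z y.
  have [/existsP[z /existsP[V /andP[/eqP pkV gV]]]|none] :=
    boolP [exists z, exists V, (pk z == Some V) && (0 < avg (fun u => g (word_join (subspace_point V u) z)))].
    have nV : nondegenerate V.
      by move: pkV; rewrite /pk; case: pickP => // V' /andP[nV' _] [<-].
    exists (suffix_subspace V z); first exact: nondegenerate_suffix.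
    by rewrite (eq_avg (g := fun u => g (word_join (subspace_point V u) z)))// => u;
      rewrite subspace_point_suffix.
  have {}none z V : pk z = Some V -> avg (fun u =>
    g (word_join (subspace_point V u) z)) <= 0.
    move=> pkV; rewrite leNgt; apply/negP => gV;
      move/existsPn: none => /(_ z)/existsPn/(_ V).
    by rewrite pkV eqxx gV.
  have W0 I : (0 < #|W I|)%N by exact: word_gt0.
  have mass z : avg (fun y => g (word_join y z) * (E (word_join y z))%:R) <=
                avg (fun y => g (word_join y z) * (E' y z)%:R).
    rewrite -subr_ge0 -avgB.
    case pkz : (pk z) => [V|]; last first.
      rewrite (eq_avg (g := fun=> 0)) ?avg_cst ?W0// => y.
      by rewrite /E' /hit pkz andbT subrr.
    have /andP[nV /forallP EV] : inside z V.
      by move: pkz; rewrite /pk; case: pickP => // V' ? [<-].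
    rewrite (eq_avg (g := fun y =>
      - (g (word_join y z) * (y \in subspace_point V @: [set: W J])%:R))).
      rewrite (eq_avg (g := fun y =>
        -1 * (g (word_join y z) * (y \in subspace_point V @: [set: W J])%:R))).
        rewrite avgZ (avg_image (fun y =>
          g (word_join y z)) (W0 J) (subspace_point_inj nV)).
        by rewrite mulN1r oppr_ge0 mulr_ge0_le0 ?(ltW c0)//; exact: none.
      by move=> y; rewrite mulN1r.
    move=> y; rewrite /E' /hit pkz.
    case: imsetP => [[u _ ->]|_]; first by rewrite EV /=; ring.
    by rewrite andbT mulr0 subrr oppr0.
  have loss z : density (E'^~ z) <=
      density (fun y => E (word_join y z)) - c * (density (fun y =>
        E (word_join y z)) - beta / 2).
    case pkz : (pk z) => [V|].
      have /andP[nV /forallP EV] : inside z V.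
        by move: pkz; rewrite /pk; case: pickP => // V' ? [<-].
      have -> : density (E'^~ z) = density (fun y => E (word_join y z)) - c :> R.
        rewrite -[c in RHS]mulr1 -(avg_cst 1 (W0 J)) /c -(avg_image (fun=> 1) (W0 J)
          (subspace_point_inj nV)).
        rewrite /density -avgB; apply: eq_avg => y; rewrite /E' /hit pkz mul1r.
        case: imsetP => [[u _ ->]|_]; first by rewrite EV /= subrr.
        by rewrite andbT subr0.
      have := density_le1 (R := R) (fun y => E (word_join y z)); nra.
    have small : density (fun y => E (word_join y z)) < beta / 2.
      rewrite ltNge; apply/negP => /HN[V nV EV].
      move: pkz; rewrite /pk; case: pickP => // /(_ V)/negP[].
      rewrite /inside nV; apply/forallP => u.
      rewrite (Ea _ (word_join (subspace_point V (lift_word (line_point u a))) z));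
        first exact: EV.
      rewrite !line_point_join; congr word_join; apply/ffunP => n; rewrite !ffunE.
      by case: (V n) => // j'; rewrite !ffunE.
    have -> : density (E'^~ z) = density (fun y => E (word_join y z)) :> R.
      by apply: eq_avg => y; rewrite /E' /hit pkz andbT.
    nra.
  have E'a y : insensitive a (E' y).
    move=> z z' zz'; have Ezz' u : E (word_join u z) = E (word_join u z').
      by apply: Ea; rewrite !line_point_join zz'.
    rewrite /E' /hit Ezz'; congr (_ && ~~ _).
    have -> // : pk z = pk z'.
    apply: eq_pick => V; congr (_ && _); apply: eq_forallb => u; exact: Ezz'.
  have q0 : 0 <= (1 - c) ^+ j by rewrite exprn_ge0// subr_ge0.
  pose F y := avg (fun z =>
    g (word_join y z) * (E' y z)%:R) - (1 - c) ^+ j * density (E' y).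
  have : beta / 2 - (1 - c) ^+ j * (beta / 2) < avg F.
    have L1 := le_avg mass; have L2 := le_avg loss.
    rewrite /F avgB avgZ avg_exchange [avg (fun y => density _)]avg_exchange.
    rewrite avgB avgZ avgB (avg_cst _ (W0 Y)) in L2.
    move: big; rewrite /density !avg_word_join.
    rewrite avg_exchange [ltRHS]avg_exchange => big.
    move: L1 L2; rewrite -/(density _).
    rewrite /density.
    set e := avg (fun y => avg (fun x => (E _)%:R)) in big *.
    set e' := avg (fun y => avg (fun x => (E' _ _)%:R)).
    set m := avg (fun y => avg (fun x => g _ * (E _)%:R)) in big *.
    set m' := avg (fun y => avg (fun x => g _ * (E' _ _)%:R)).
    move=> L1 L2; apply: lt_le_trans (_ : m' - (1 - c) ^+ j * (e - c * (e - beta / 2))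
      <= _).
      apply: lt_le_trans (_ : m - (1 - c) ^+ j * (e - c * (e - beta / 2)) <= _).
        by move: big; rewrite exprSr; lra.
      by rewrite lerD2r.
    by rewrite lerD2l lerN2 ler_wpM2l.
  move=> /(avg_lt_ex (W0 N))[y]; rewrite /F ltrBrDr => Hy.
  have [||V nV HV] := IH a (E' y) (fun z => g (word_join y z)) (E'a y) _ _.
  - by [].
  - by apply: le_lt_trans Hy; lra.
  exists (prefix_subspace y V); first exact: nondegenerate_prefix.
  by rewrite (eq_avg (g := fun u => g (word_join y (subspace_point V u))))// => u;
    rewrite subspace_point_prefix.
have [j Hj] : exists j, (1 - c) ^+ j < beta / 2.
  by apply: expr_small; rewrite ?subr_ge0 ?ltrBlDr ?ltrDl.
have [Y HY] := claim j; exists Y => a E g Ea g1 bg.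
apply: HY Ea g1 _; apply: le_lt_trans bg.
have := density_le1 (R := R) E; have : 0 <= (1 - c) ^+ j by rewrite exprn_ge0// subr_ge0.
by nra.
Qed.

Lemma insensitive_subspace I J (V : {ffun I -> option K + J}) a (E : pred
  {ffun I -> option K}) :
  insensitive a E -> insensitive a (fun u => E (subspace_point V u)).
Proof.
move=> Ea u u' /ffunP uu'; apply: Ea; apply/ffunP => i.
by rewrite !ffunE; case: (V i) => // j; have := uu' j; rewrite !ffunE.
Qed.

(** One insensitive set is eliminated at a time: applying [insensitive_increment] to
[g] times the indicator of the remaining sets, minus [beta / 2], leaves a
subspace on which the average over the remaining sets exceeds [beta / 2]. *)
Lemma insensitive_inter_increment r J (beta : R) : 0 < beta -> exists Y : finType,
  forall (s : seq K) (E : K -> pred {ffun Y -> option K}) (g : {ffun Y -> option K} -> R),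
  (size s <= r)%N -> (forall a, insensitive a (E a)) -> (forall y, g y <= 1) ->
  beta < avg (fun y => g y * (all (E^~ y) s)%:R) ->
  exists2 V : {ffun Y -> option K + J}, nondegenerate V & 0 < avg (fun u =>
    g (subspace_point V u)).
Proof.
elim: r beta => [|r IH] beta beta0.
  exists J => s E g; rewrite leqn0 => /nilP -> _ _ bg.
  exists [ffun j => inr j]; first by apply/nondegenerateP => j; exists j; rewrite ffunE.
  apply: lt_trans beta0 _; apply: lt_le_trans bg _.
  rewrite le_eqVlt; apply/orP; left; apply/eqP; apply: eq_avg => y /=.
  by rewrite mulr1; congr g; apply/ffunP => j; rewrite !ffunE.
have b20 : 0 < beta / 2 by rewrite divr_gt0// ltr0n.
have [Y1 H1] := IH _ b20; have [Y H] := insensitive_increment Y1 b20.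
have /card_gt0P[a0 _] := K0.
exists Y => s E g sr Ei g1 bg.
have [a [Ea [s' [s'r Ea_insens sE]]]] : exists a (Ea : pred {ffun Y -> option K}) s',
    [/\ (size s' <= r)%N, insensitive a Ea & forall y, all (E^~ y) s = Ea y && all (E^~ y) s'].
  case: s sr bg => [_ _|a s' sr _]; first by exists a0, predT, [::].
  by exists a, (E a), s'.
pose g' y := g y * (all (E^~ y) s')%:R - beta / 2.
have [||V nV] := H a Ea g' Ea_insens.
- move=> y; rewrite /g' lerBlDr; have := g1 y.
  by case: (all _ _) => /=; rewrite ?mulr1 ?mulr0; lra.
- have : beta - beta / 2 < avg (fun y => g y * (all (E^~ y) s)%:R - beta / 2).
    by rewrite avgB avg_cst ?word_gt0// ltrD2r.
  rewrite {1}(splitr beta) addrK => /lt_le_trans; apply; apply: le_avg => y.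
  by rewrite sE /g'; case: (Ea y) => /=; rewrite ?mulr1 ?mulr0//; lra.
rewrite /g' avgB avg_cst ?word_gt0// subr_gt0 => HV.
have [||V' nV' HV'] := H1 s' (fun a u => E a (subspace_point V u)) (fun u =>
  g (subspace_point V u)) s'r _ _ HV.
- by move=> b; apply: insensitive_subspace.
- by [].
exists (comp_subspace V V'); first exact: nondegenerate_comp.
by rewrite (eq_avg (g := fun u => g (subspace_point V (subspace_point V' u))))// => u;
  rewrite subspace_point_comp.
Qed.

(** The complement of an intersection is the disjoint union, over [b], of the
points at which [D b] is the first condition to fail. *)
Lemma first_failure (T : finType) (f : T -> R) (D : K -> pred T) (s : seq K) e :
  uniq s -> (size s)%:R * e < avg (fun y => f y * (~~ all (D^~ y) s)%:R) ->
  exists s1 b, [/\ (size s1 < size s)%N, b \notin s1 &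
    e < avg (fun y => f y * (all (D^~ y) s1 && ~~ D b y)%:R)].
Proof.
elim/last_ind: s => [_|s b IH].
  by rewrite mul0r (eq_avg (g := fun=> 0 * 0)) ?avgZ ?mul0r ?ltxx// => y;
    rewrite /= !mulr0.
rewrite rcons_uniq size_rcons => /andP[bs us] H.
have [He|He] := ltP e (avg (fun y => f y * (all (D^~ y) s && ~~ D b y)%:R)).
  by exists s, b.
have [|s1 [b' [s1s b's1 H']]] := IH us.
  move: H; rewrite (eq_avg (g := fun y => f y * (~~ all (D^~ y) s)%:R +
      f y * (all (D^~ y) s && ~~ D b y)%:R)).
    by rewrite avgD -natr1 mulrDl mul1r; lra.
  by move=> y; rewrite all_rcons; case: (all _ _); case: (D b y);
    rewrite /= ?mulr0 ?addr0 ?add0r.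
by exists s1, b'; split=> //; exact: ltnW.
Qed.

(** The complement is split by [first_failure] into [#|K|] intersections of
insensitive sets; one of them carries enough of the average. *)
Lemma insensitive_compl_increment J (beta : R) : 0 < beta -> exists Y : finType,
  forall (D : K -> pred {ffun Y -> option K}) (g : {ffun Y -> option K} -> R),
  (forall a, insensitive a (D a)) -> (forall y, g y <= 1) ->
  #|K|%:R * beta < avg (fun y => g y * (~~ [forall a, D a y])%:R) ->
  exists2 V : {ffun Y -> option K + J}, nondegenerate V & 0 < avg (fun u =>
    g (subspace_point V u)).
Proof.
move=> beta0; have [Y H] := insensitive_inter_increment #|K| J beta0.
exists Y => D g Di g1;
  rewrite (eq_avg (g := fun y => g y * (~~ all (D^~ y) (enum K))%:R)).
  rewrite [in X in X%:R]cardE => /(first_failure (enum_uniq K))[s1 [b [s1K bs1 Hb]]].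
  pose E a : pred {ffun Y -> option K} := if a == b then fun y => ~~ D b y else D a.
  apply: (H (b :: s1) E g) => //.
  - by rewrite cardE.
  - move=> a; rewrite /E; case: eqP => [->|_]; last exact: Di.
    by move=> y y' /Di ->.
  - rewrite (eq_avg (g := fun y => g y * (all (D^~ y) s1 && ~~ D b y)%:R))// => y /=.
    rewrite {1}/E eqxx andbC; congr (_ * (_ && _)%:R).
    apply: eq_in_all => a as1; rewrite /E; case: eqP => // ab.
    by rewrite -ab as1 in bs1.
move=> y; congr (_ * (~~ _)%:R).
by apply/forallP/allP => [H' a _|H' a]; [|apply: H'; rewrite mem_enum].
Qed.

End OptionStep.
End Increment.

(** * The induction on the alphabet *)

Section Step.
Context {R : archiRealFieldType}.
Context {K : finType}.
Hypotheses (K0 : (0 < #|K|)%N) (dhj : @DHJ R K).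
Implicit Types I J M Z : finType.

Notation W I := ({ffun I -> option K} : finType).

Definition lift_line I (y : {ffun I -> option K}) : {ffun I -> option (option K)} :=
  [ffun i => omap Some (y i)].

Lemma line_point_lift_line_None I (y : {ffun I -> option K}) : line_point (lift_line
  y) None = y.
Proof. by apply/ffunP => i; rewrite !ffunE; case: (y i). Qed.

Lemma line_point_lift_line_Some I (y : {ffun I -> option K}) a :
  line_point (lift_line y) (Some a) = lift_word (line_point y a).
Proof. by apply/ffunP => i; rewrite !ffunE; case: (y i). Qed.

Lemma subspace_point_cons I J (L : finType) (c : L) (V : {ffun I -> L + J}) u :
  subspace_point (word_cons (inl c) V) u = word_cons c (subspace_point V u).
Proof. by apply/ffunP => -[i|]; rewrite !ffunE. Qed.

Lemma nondegenerate_cons I J (L : finType) (c : L) (V : {ffun I -> L + J}) :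
  nondegenerate V -> nondegenerate (word_cons (inl c) V).
Proof.
move=> /nondegenerateP nV; apply/nondegenerateP => j; have [i Vi] := nV j.
by exists (Some i); rewrite ffunE.
Qed.

Lemma avg_lower_bound (T : finType) (f : T -> R) (d e : R) (x : T) : 0 <= e ->
  d <= avg f ->
  (forall y, f y <= d + e / #|T|%:R) -> d - e <= f x.
Proof.
move=> e0 df fe; have T0 : (0 < #|T|)%N by apply/card_gt0P; exists x.
have T0R : (0 : R) < #|T|%:R by rewrite ltr0n.
have : d * #|T|%:R <= f x + (#|T|%:R - 1) * (d + e / #|T|%:R).
  rewrite -ler_pdivlMr// (le_trans df)// /avg ler_wpM2r ?invr_ge0 ?ler0n//.
  rewrite (bigD1 x)//=. rewrite lerD2l.
  apply: (@le_trans _ _ (\sum_(y | y != x) (d + e / #|T|%:R))); first exact: ler_sum.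
  rewrite sumr_const -[_ *+ _]mulr_natl -[#|_|]/(#|predC1 x|) cardC1.
  suff -> : #|T|.-1%:R = #|T|%:R - 1 :> R by [].
  by rewrite -[in RHS](prednK T0) -natr1 addrK.
have : 0 <= e / #|T|%:R by rewrite divr_ge0// ltW.
have : (#|T|%:R - 1) * (e / #|T|%:R) = e - e / #|T|%:R.
  by rewrite mulrBl mul1r mulrCA mulfV ?mulr1 ?gt_eqF.
have T1 : (1 : R) <= #|T|%:R by rewrite ler1n.
rewrite mulrDr; nra.
Qed.

(** The order of the quantifiers allows two nested descents: the gain [g] of the
third case depends on [d0] only, while the gain [g1] of the second one also
depends on the dimension [J].  The subspace of the block provided by
[line_ramsey] has one spare parameter, which is kept equal to [None] so that all
the points considered are lines over [K]. *)
Lemma density_increment (d0 : R) : 0 < d0 -> d0 <= 1 -> exists2 g, 0 < g &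
  forall J, exists M : finType, exists2 g1, 0 < g1 &
  forall Z d (A : pred {ffun M + Z -> option K}), d0 <= d -> d <= density A ->
  [\/ exists2 y, is_line y & forall a, A (line_point y a),
      exists y, d + g1 <= density (fun z => A (word_join y z))
    | exists z, exists2 V : {ffun M -> option K + J}, nondegenerate V &
        d + g <= density (fun u => A (word_join (subspace_point V u) z))].
Proof.
move=> d0p d01; have /card_gt0P[a0 _] := K0.
have W0 I : (0 < #|W I|)%N by rewrite word_gt0// card_option.
have d20 : 0 < d0 / 2 by rewrite divr_gt0// ltr0n.
have d40 : 0 < d0 / 2 / 2 by rewrite divr_gt0// ltr0n.
have [n Hn] := dhj d40.
(* [#|W 'I_n|] bounds the number of lines over [K] of dimension [n], among which
   a popular one is chosen. *)
pose th := d0 / 2 / 2 / #|W 'I_n|%:R.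
have th0 : 0 < th by rewrite divr_gt0// ltr0n W0.
have th1 : th <= 1.
  rewrite ler_pdivrMr ?ltr0n ?W0// mul1r.
  apply: (@le_trans _ _ 1); first by lra.
  by rewrite ler1n W0.
pose g := d0 * th / 4.
have g0 : 0 < g by apply: divr_gt0; [exact: mulr_gt0 | rewrite ltr0n].
have gd : g <= d0 / 2 by rewrite /g; nra.
exists g => // J.
have k0 : (0 : R) < #|K|%:R by rewrite ltr0n.
have beta0 : 0 < g / #|K|%:R by rewrite divr_gt0.
have [Y HY] := insensitive_compl_increment K0 dhj J beta0.
have [M HM] := line_ramsey a0 (DHJ_HJ K0 dhj) 'I_n (option Y).
have WM0 : (0 : R) < #|W M|%:R by rewrite ltr0n W0.
exists M, (g / #|W M|%:R); first by rewrite divr_gt0.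
move=> Z d A d0d dA.
have [/existsP[y Hy]|/existsPn noy] :=
  boolP [exists y : W M, d + g / #|W M|%:R <= density (fun z => A (word_join y z)) :> R].
  by apply: Or32; exists y.
have low y : d - g <= density (fun z => A (word_join y z)).
  move: dA; rewrite {1}/density avg_word_join => dA.
  apply: (avg_lower_bound (f := fun y => density (fun z =>
    A (word_join y z))) _ (ltW g0) dA) => y'.
  by rewrite ltW// ltNge; exact: noy.
pose chi (y : {ffun M -> option K}) :=
  th <= density (fun z => [forall a, A (word_join (lift_word (line_point y a)) z)]).
have [[V nV badV]|[V nV goodV]] := HM chi.
  exfalso.
  pose f (z : W Z) : R := density (fun u : {ffun 'I_n -> K} =>
    A (word_join (lift_word (subspace_point V u)) z)).
  have df : d0 / 2 <= avg f.
    rewrite /f /density avg_exchange -(avg_cst (d0 / 2) (word_gt0 'I_n K0)).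
    by apply: le_avg => u; apply: le_trans (low _); lra.
  pose rel (z : W Z) (y : W 'I_n) :=
    is_line y && [forall a, A (word_join (lift_word (subspace_point V (line_point y a))) z)].
  have [|z|y Hy] := @popular_witness R _ _ _ rel _ d40 (avg_half (ltW d20) _ df).
  - by move=> z; exact: density_le1.
  - move=> /Hn[]; first by rewrite card_ord.
    by move=> y yl Hy; exists y; rewrite /rel yl; apply/forallP.
  have [z] := avg_lt_ex (W0 Z) (lt_le_trans th0 Hy).
  rewrite ltr0n lt0b => /andP[yl _].
  move: (badV y yl) => /negP[]; apply: le_trans Hy _; apply: le_avg => z'.
  rewrite /rel yl /= ler_nat leq_eqVlt; apply/orP; left; apply/eqP; congr (nat_of_bool _).
  by apply: eq_forallb => a; rewrite line_point_subspace.
pose P (z : W Z) (y : W Y) := A (word_join (subspace_point (lift_subspace V)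
  (word_cons None y)) z).
pose D (z : W Z) (a : K) (y : W Y) :=
  A (word_join (lift_word (subspace_point V (line_point (word_cons None y) a))) z).
have lineY y : is_line (word_cons None y : {ffun option Y -> option K}).
  by apply/is_lineP; exists None; rewrite ffunE.
have [/existsP[z /existsP[y /andP[Py /forallP Dy]]]|noline] :=
  boolP [exists z, exists y, P z y && [forall a, D z a y]].
  apply: Or31; exists (word_join (lift_line (subspace_point (lift_subspace V)
    (word_cons None y))) (lift_word z)).
    have /is_lineP[m Hm] := is_line_subspace nV (lineY y).
    by apply/is_lineP; exists (inl m); rewrite ffunE ffunE Hm.
  move=> [a|]; rewrite line_point_join line_point_lift_word.
    by rewrite line_point_lift_line_Some line_point_subspace; exact: Dy.
  by rewrite line_point_lift_line_None.
apply: Or33.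
pose G (z : W Z) (y : W Y) : R := (P z y)%:R - (d + g).
have dg0 : 0 <= d + g by lra.
(* As [P] and the intersection of the [D a] are disjoint, removing the latter
   costs nothing to [P] and gains [d + g] times its density, at least [th]. *)
have : g < avg (fun z => avg (fun y => G z y * (~~ [forall a, D z a y])%:R)).
  have GE z y : G z y * (~~ [forall a, D z a y])%:R =
    (P z y)%:R - (d + g) + (d + g) * [forall a, D z a y]%:R.
    move/existsPn: noline => /(_ z)/existsPn/(_ y); rewrite /G.
    by case: (P z y); case: [forall a, _] => //= _; ring.
  rewrite (eq_avg (g := fun z => avg (fun y =>
    (P z y)%:R - (d + g) + (d + g) * [forall a, D z a y]%:R))); last first.
    by move=> z; apply: eq_avg => y.
  rewrite avg_exchange.
  apply: lt_le_trans (_ : d - g - (d + g) + (d + g) * th <= _).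
    by rewrite /g; nra.
  rewrite -(avg_cst (_ + _ * th) (W0 Y)); apply: le_avg => y.
  rewrite avgD avgB avg_cst ?W0// avgZ.
  have := low (subspace_point (lift_subspace V) (word_cons None y));
    rewrite -/(P _ y) => lowy.
  have := goodV _ (lineY y); rewrite /chi => thy.
  apply: lerD; first by rewrite lerD2r.
  apply: ler_wpM2l => //; apply: le_trans thy _; apply: le_avg => z.
  rewrite ler_nat leq_eqVlt; apply/orP; left; apply/eqP; congr (nat_of_bool _).
  by apply: eq_forallb => a; rewrite line_point_subspace.
move=> /(avg_lt_ex (W0 Z))[z Hz].
have [|||X nX HX] := HY (D z) (G z).
- move=> a y y' yy'; rewrite /D; congr (A (word_join (lift_word (subspace_point V _)) z)).
  by rewrite !line_point_cons yy'.
- by move=> y; rewrite /G; case: (P z y) => /=; lra.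
- by rewrite mulrCA mulfV ?mulr1// gt_eqF.
exists z, (comp_subspace (lift_subspace V) (word_cons (inl None) X)).
  by apply: nondegenerate_comp; [exact: nondegenerate_lift | exact: nondegenerate_cons].
move: HX; rewrite /G avgB avg_cst ?W0// subr_gt0 => /ltW/le_trans; apply.
apply: le_avg => u; rewrite subspace_point_comp subspace_point_cons; exact: lexx.
Qed.

(** Two nested descents on the density: the outer one in steps of [g], and for each
dimension so obtained an inner one in steps of [g1]. *)
Lemma DHJ_option_of_DHJ : @DHJ R (option K).
Proof.
have oK0 : (0 < #|{: option K}|)%N by rewrite card_option.
apply: DHJ_of_ex => // d dp.
pose P (x : R) := exists I, DHJ_at (option K) I x.
have Pmono x y : x <= y -> P x -> P y.
  by move=> xy [I HI]; exists I => A /(le_trans xy); exact: HI.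
have Ptriv x : 1 < x -> P x.
  move=> x1; exists unit => A /(lt_le_trans x1); rewrite ltNge => /negP[].
  exact: density_le1.
have [d1|d1] := leP d 1; last exact: Ptriv.
have [g g0 Hg] := density_increment dp d1.
apply: (@descent R P d 2 g) => //; first last.
- by apply: Ptriv; lra.
- by lra.
move=> x dx _ [J HJ].
have [M [g1 g10 H]] := Hg J.
apply: (@descent R P x (x + g) g1) => //; last 2 first.
- by lra.
- by exists J.
move=> x' xx' x'g [Z HZ]; exists (M + Z)%type => A /H[]; first exact: le_trans xx'.
- by [].
- move=> [y /HZ[l /is_lineP[p lp] Hl]]; exists (word_join (lift_word y) l).
    by apply/is_lineP; exists (inr p); rewrite ffunE.
  by move=> a; rewrite line_point_join line_point_lift_word.
- move=> [z [V nV dV]];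
  have [|l ll Hl] := HJ (fun u => A (word_join (subspace_point V u) z)).
    by apply: le_trans dV; rewrite lerD2r.
  exists (word_join (subspace_point (lift_subspace V) l) (lift_word z)).
    have /is_lineP[m Hm] := is_line_subspace nV ll.
    by apply/is_lineP; exists (inl m); rewrite ffunE.
  by move=> a; rewrite line_point_join line_point_lift_word line_point_subspace.
Qed.

End Step.

Theorem density_Hales_Jewett (R : archiRealFieldType) (K : finType) :
  (0 < #|K|)%N -> @DHJ R K.
Proof.
elim/finType_ind: K => [K L e be IH L0||K IH _]; last 1 first.
- have [K0|K0] := posnP #|K|; last by apply: DHJ_option_of_DHJ => //; exact: IH.
  move=> d d0; exists 1%N => I I0 A dA.
  have oK0 : (0 < #|{: option K}|)%N by rewrite card_option.
  have [w] := avg_lt_ex (word_gt0 _ oK0) (lt_le_trans d0 dA).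
  rewrite ltr0n lt0b => Aw; exists [ffun=> None].
    by have /card_gt0P[i _] := I0; apply/is_lineP; exists i; rewrite ffunE.
  move=> a; congr (is_true (A _)): Aw; apply/ffunP => i.
  have /fintype_le1P oK1 : (#|{: option K}| <= 1)%N by rewrite card_option K0.
  exact: oK1.
- have KL : #|K| = #|L| by apply: bij_eq_card be.
  have [e' eK e'K] := be.
  move=> d d0; have [|n Hn] := IH _ d d0; first by rewrite KL.
  exists n => I nI A dA.
  pose h (w : {ffun I -> K}) : {ffun I -> L} := [ffun i => e (w i)].
  have bh : bijective h.
    exists (fun w : {ffun I -> L} => [ffun i => e' (w i)]) => w; apply/ffunP => i.
      by rewrite !ffunE eK.
    by rewrite !ffunE e'K.
  move: dA; rewrite /density (avg_bij _ bh) => /(Hn I nI)[y /is_lineP[i yi] Hy].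
  exists [ffun i => omap e (y i)]; first by apply/is_lineP; exists i; rewrite ffunE yi.
  move=> b; have := Hy (e' b); congr (is_true (A _)); apply/ffunP => p.
  by rewrite !ffunE; case: (y p) => //=; rewrite e'K.
- by rewrite card_void.
Qed.

Local Open Scope classical_set_scope.

(** * From lines to returns of positive measure *)

Section Recurrence.
Context {R : realType} {d : measure_display} {X : measurableType d}.
Variable mu : probability X R.

Lemma sum_measure_le (I J : finType) (a : I -> R) (E : I -> set X) (b : J ->
  R) (F : J -> set X) :
  (forall i, 0 <= a i) -> (forall i, measurable (E i)) ->
  (forall j, 0 <= b j) -> (forall j, measurable (F j)) ->
  (forall x, \sum_i a i * \1_(E i) x <= \sum_j b j * \1_(F j) x) ->
  (\sum_i (a i)%:E * mu (E i) <= \sum_j (b j)%:E * mu (F j))%E.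
Proof.
have integ (L : finType) (c : L -> R) (G : L -> set X) : (forall i, 0 <= c i) ->
    (forall i, measurable (G i)) ->
    (\sum_i (c i)%:E * mu (G i) = \int[mu]_x (\sum_i c i * \1_(G i) x)%:E)%E.
  move=> c0 mG.
  under [RHS]eq_integral do rewrite -sumEFin.
  rewrite ge0_integral_sum//; first last.
  - by move=> i x _; rewrite lee_fin mulr_ge0 ?c0.
  - by move=> i; apply/measurable_EFinP; apply: measurable_funM => //;
    exact: measurable_indic.
  apply: eq_bigr => i _.
  under [RHS]eq_integral do rewrite EFinM.
  rewrite ge0_integralZl//; first by rewrite integral_indic// setIT.
  - by apply/measurable_EFinP; exact: measurable_indic.
  - by rewrite lee_fin c0.
move=> a0 mE b0 mF le; rewrite !integ//; apply: ge0_le_integral => //.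
- by move=> x _; rewrite lee_fin sumr_ge0// => i _; rewrite mulr_ge0.
- by apply/measurable_EFinP; apply: measurable_sum => i; apply: measurable_funM => //;
  exact: measurable_indic.
- by apply/measurable_EFinP; apply: measurable_sum => i; apply: measurable_funM => //;
  exact: measurable_indic.
- by move=> x _; rewrite lee_fin.
Qed.

Lemma measure_preserving_id : measure_preserving mu idfun.
Proof. by split; [exact: measurable_id|]. Qed.

Lemma measure_preserving_comp (f g : X -> X) :
  measure_preserving mu f -> measure_preserving mu g -> measure_preserving mu (f \o g).
Proof.
move=> [mf pf] [mg pg]; split; first exact: measurableT_comp.
by move=> A mA; rewrite comp_preimage pg ?pf// -[_ @^-1` _]setTI; exact: mf.
Qed.

(** If every line had a null set of common returns, then for almost every [x] the
set of words sending [x] into [A] would contain no line and have density less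
than [e]; integration gives [mu A <= e]. *)
Lemma line_of_returns (K I : finType) (S : {ffun I -> K} -> X -> X) (A : set X) (e : R) :
  (0 < #|K|)%N -> measurable A -> (forall w, measure_preserving mu (S w)) ->
  (e%:E < mu A)%E -> 0 < e -> DHJ_at K I e ->
  exists2 y : {ffun I -> option K}, is_line y &
    (0 < mu (\bigcap_(a in [set: K]) (S (line_point y a) @^-1` A)))%E.
Proof.
move=> K0 mA mpS eA e0 dhj; apply: contrapT => noline.
have W0 : (0 < #|{ffun I -> K}|)%N by exact: word_gt0.
have W0R : (0 : R) < #|{ffun I -> K}|%:R by rewrite ltr0n.
have mS w : measurable (S w @^-1` A) by rewrite -[_ @^-1` _]setTI; apply: (mpS w).1.
pose B (y : {ffun I -> option K}) := \bigcap_(a in [set: K]) (S (line_point y a) @^-1` A).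
have mB y : measurable (B y) by apply: fin_bigcap_measurable.
have B0 y : is_line y -> mu (B y) = 0.
  move=> yl; apply/eqP; apply/negPn/negP => B0; apply: noline; exists y => //.
  by rewrite lt0e B0 measure_ge0.
pose c (o : option {y : {ffun I -> option K} | is_line y}) : R := 
  if o is Some y then #|{ffun I -> K}|%:R else #|{ffun I -> K}|%:R * e.
pose F (o : option {y : {ffun I -> option K} | is_line y}) : set X :=
  if o is Some y then B (val y) else setT.
have : (\sum_(w : {ffun I -> K}) 1%:E * mu (S w @^-1` A) <= \sum_o (c o)%:E * mu (F o))%E.
  apply: (sum_measure_le (a := fun=> 1)) => //.
  - by case=> [y|] /=; rewrite ?ler0n// mulr_ge0 ?ler0n// ltW.
  - by case=> [y|]; [exact: mB | exact: measurableT].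
  - move=> x.
    have c0 o : 0 <= c o * \1_(F o) x.
      by rewrite mulr_ge0//; case: o => [y|] /=; rewrite ?ler0n// mulr_ge0 ?ler0n// ltW.
    have sE : \sum_w 1 * \1_(S w @^-1` A) x = #|{ffun I -> K}|%:R * density (fun w =>
      S w x \in A) :> R.
      rewrite /density /avg mulrC divfK ?gt_eqF//; apply: eq_bigr => w _.
      by rewrite mul1r indicE; congr (nat_of_bool _)%:R; apply/idP/idP; rewrite !inE.
    rewrite sE; have [/dhj[y yl Hy]|de] := leP e (density (fun w => S w x \in A)).
      rewrite (bigD1 (Some (exist _ y yl)))//=.
      apply: (@le_trans _ _ #|{ffun I -> K}|%:R).
        by rewrite -[leRHS]mulr1 ler_pM2l// density_le1.
      rewrite indicE mem_set ?mulr1 ?lerDl ?sumr_ge0// => a _ /=.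
      exact: set_mem (Hy a).
    rewrite (bigD1 None)//= indicE in_setT mulr1.
    by rewrite (le_trans (_ : _ <= #|{ffun I -> K}|%:R * e))// ?lerDl ?sumr_ge0//
      ler_pM2l// ltW.
have -> : (\sum_o (c o)%:E * mu (F o) = (#|{ffun I -> K}|%:R * e)%:E)%E.
  rewrite (bigD1 None)//= probability_setT mule1 big1 ?adde0//.
  by move=> [[y yl]|]//= _; rewrite B0// mule0.
have muA : (mu : {measure set X -> \bar R}) A = (fine (mu A))%:E by rewrite fineK//
  fin_num_measure.
under eq_bigr do rewrite mul1e (mpS _).2// muA.
rewrite sumEFin sumr_const lee_fin -[_ *+ _]mulr_natl ler_pM2l// leNgt.
by rewrite -lte_fin -[X in (_ < X)%E]muA eA.
Qed.

End Recurrence.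

(** * Rational numbers with digits 0 and 1 *)

Section IndicatorRational.
Context {n : nat}.
Variable P : pred 'I_n.

(** The digit at position [i + 1] records whether [i] satisfies [P], since position
0 carries no digit. *)
Definition indicator_digits (t : int) : nat :=
  if t is Posz m.+1 then (if insub m is Some i then nat_of_bool (P i) else 0%N) else 0%N.

Lemma indicator_digits_ord (i : 'I_n) : indicator_digits (i.+1)%:Z = P i.
Proof. by rewrite /indicator_digits valK. Qed.

Lemma indicator_rational_exists : exists q : rat, forall t,
  digit q t = indicator_digits t.
Proof.
exists (\sum_(1 <= s < n.+1) (indicator_digits (- s%:Z))%:R * ((-1) ^+ s / (s.+1)`!%:R)
      + \sum_(1 <= r < n.+1) (indicator_digits r%:Z)%:R * ((-1) ^+ r.+1 * r`!%:R)).
apply: has_digits_unique (digitP _) _; split.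
  move=> [[|m]|m] //=; case: insubP => //= i _ _; by case: (P i).
exists n; split=> // -[[|m]|m] //= nm.
by case: insubP => //= i; rewrite ltnNge -ltnS nm.
Qed.

Lemma dom_indicator (q : rat) : (forall t, digit q t = indicator_digits t) ->
  dom q = [seq (val i).+1%:Z | i <- enum 'I_n & P i].
Proof.
move=> qP; apply: (@irr_sorted_eq _ <%O lt_trans ltxx).
- by rewrite sort_lt_sorted fset_uniq.
- have -> : sorted <%O [seq (val i).+1%:Z | i <- enum 'I_n & P i]
      = sorted (fun i j : 'I_n => (i < j)%N) [seq i <- enum 'I_n | P i].
    by rewrite sorted_map; apply: eq_sorted => i j /=; rewrite ltz_nat ltnS.
  apply: sorted_filter; first by move=> j i l; exact: ltn_trans.
  by have := iota_ltn_sorted 0 n; rewrite -val_enum_ord sorted_map.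
move=> t; rewrite mem_dom qP; apply/idP/mapP => [|[i]].
  case: t => [[|m]|m] //=; case: insubP => //= i _ im.
  by case Pi : (P i) => // _; rewrite -im; exists i => //;
    rewrite mem_filter Pi mem_enum inE.
by rewrite mem_filter => /andP[Pi _] ->; rewrite indicator_digits_ord Pi.
Qed.

Lemma rational_system_indicator (X : Type) (T : int -> X -> X) (q : rat) :
  (forall t, digit q t = indicator_digits t) ->
  rational_system T q =
  foldr (fun i f => if P i then T (val i).+1%:Z \o f else f) idfun (enum 'I_n).
Proof.
move=> qP; rewrite /rational_system (dom_indicator qP).
elim: (enum 'I_n) => //= i s IH; case Pi : (P i) => //=.
by rewrite IH qP indicator_digits_ord Pi.
Qed.

Lemma indicator_neq0 (q : rat) i : P i ->
  (forall t, digit q t = indicator_digits t) -> q != 0.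
Proof.
move=> Pi qP; apply/eqP => q0.
have z0 : has_digits 0 (fun=> 0%N).
  by split=> //; exists 0%N; split=> //; rewrite !big_geq// addr0.
have := has_digits_unique (digitP 0) z0 (val i).+1%:Z.
by rewrite -q0 qP indicator_digits_ord Pi.
Qed.

End IndicatorRational.

(** * Words acting by commuting transformations *)

Section LetterWords.
Context {X : Type} {k n : nat}.
Variable T : 'I_k -> int -> X -> X.

(** The letter [None] is the identity, so that the point of a line with wildcard
[None] is the starting point of the other ones. *)
Definition letter (i : 'I_n) (o : option 'I_k) : X -> X :=
  if o is Some j then T j (val i).+1%:Z else idfun.

Definition act_word (s : seq 'I_n) (w : {ffun 'I_n -> option 'I_k}) : X -> X :=
  foldr (fun i f => letter i (w i) \o f) idfun s.

Hypothesis hT : forall j, commuting_transformations (T j).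
Hypothesis hTT : forall i j, i != j -> commuting_systems (T i) (T j).

Lemma letter_comm i i' o o' x : letter i o (letter i' o' x) = letter i' o' (letter i o x).
Proof.
case: o o' => [j|] [j'|] //=; have [<-|jj'] := eqVneq j j'; first exact: hT.
exact: (hTT jj').
Qed.

(** The maps at the wildcard positions can be moved to the left because all the
transformations involved commute. *)
Lemma act_word_line_point (y : {ffun 'I_n -> option (option 'I_k)}) (j : 'I_k) s x :
  act_word s (line_point y (Some j)) x =
  foldr (fun i f => if y i == None then T j (val i).+1%:Z \o f else f) idfun s
    (act_word s (line_point y None) x).
Proof.
pose G s' : X -> X :=
  foldr (fun i f => if y i == None then T j (val i).+1%:Z \o f else f) idfun s'.
rewrite -/(G s).
have comm i o s' z : letter i o (G s' z) = G s' (letter i o z).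
  elim: s' z => //= i' s' IH z; case: ifP => //= _.
  by rewrite -IH; exact: (letter_comm i i' o (Some j)).
elim: s => //= i s IH; rewrite !ffunE IH.
by case: (y i) => [c|] //=; rewrite -comm.
Qed.

End LetterWords.

Theorem theorem1p4 (R : realType) (d : measure_display) (X : measurableType d)
    (mu : probability X R) (k : nat) (hk : (0 < k)%N)
    (T : 'I_k -> int -> X -> X)
    (hmp : forall (j : 'I_k) (n : int), n != 0 -> measure_preserving mu (T j n))
    (hT : forall j : 'I_k, commuting_transformations (T j))
    (hTT : forall i j : 'I_k, i != j -> commuting_systems (T i) (T j))
    (A : set X) (hA : measurable A) (hA0 : (0 < mu A)%E) :
  exists q : rat, q != 0 /\
    (0 < mu (A `&` \bigcap_(j in [set: 'I_k])
                     (rational_system (T j) q @^-1` A)))%E.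
Proof.
have muA : mu A = (fine (mu A))%:E by rewrite fineK// fin_num_measure.
pose e : R := fine (mu A) / 2.
have e0 : 0 < e by rewrite divr_gt0// -lte_fin -muA.
have eA : (e%:E < mu A)%E by rewrite muA lte_fin /e; rewrite muA lte_fin in hA0; lra.
have K0 : (0 < #|{: option 'I_k}|)%N by rewrite card_option.
have [n /(_ 'I_n)dhj] := density_Hales_Jewett K0 e0.
have mpT i o : measure_preserving mu (letter T i o : X -> X).
  by case: o => [j|]; [exact: hmp | exact: measure_preserving_id].
pose S : {ffun 'I_n -> option 'I_k} -> X -> X := act_word T (enum 'I_n).
have mpS w : measure_preserving mu (S w).
  rewrite /S; elim: (enum 'I_n) => [|i s IH]; first exact: measure_preserving_id.
  exact: measure_preserving_comp.
have [|y /is_lineP[i yi] Hy] := line_of_returns K0 hA mpS eA e0 (dhj _).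
  by rewrite card_ord.
have [q qP] := indicator_rational_exists (fun i => y i == None).
exists q; split; first by apply: (indicator_neq0 (i := i)) qP; rewrite yi.
have mpq j : measure_preserving mu (rational_system (T j) q).
  rewrite (rational_system_indicator _ qP).
  elim: (enum 'I_n) => [|l s IH] /=; first exact: measure_preserving_id.
  by case: ifP => // _; apply: measure_preserving_comp => //; exact: hmp.
set C := A `&` _.
have mC : measurable C.
  apply: measurableI => //; apply: fin_bigcap_measurable => // j _.
  by rewrite -[_ @^-1` _]setTI; apply: (mpq j).1.
rewrite -((mpS (line_point y None)).2 C mC); congr (0 < mu _)%E: Hy.
apply/seteqP; split => x /=.
  move=> H; split; first exact: (H None).
  move=> j _ /=; rewrite (rational_system_indicator _ qP) /S -act_word_line_point//.
  exact: (H (Some j)).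
move=> [H1 H2] [j|] _ //=.
rewrite /S act_word_line_point// -(rational_system_indicator (T j) qP).
exact: H2.
Qed.
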